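(* There exist absolute constants $C_1, C_2 > 0$ such that the following holds. Let $D$ be a positive integer, let $K$ be a real number, and let $A$ be a non-empty finite subset of $\mathbf{Z}^D$ with $|A+A| \leq K|A|$. Then there is a set $A' \subseteq A$ with $|A'| \geq K^{-C_1/2}|A|$ and $\dim A' \leq C_2 \log K$.
   Context: $A+A = \{a+a' : a,a'\in A\}$. For a non-empty finite set $B \subset \mathbf{Z}^D$, $\dim B$ denotes the dimension of the smallest affine subspace (coset of a linear subspace) of $\mathbf{R}^D$ containing $B$. Logarithms are natural. The constants $C_1,C_2$ do not depend on $D$, $K$ or $A$. *)

(* Defs.v *)
From HB Require Import structures.
From mathcomp Require Import all_boot all_order all_algebra finmap.
From mathcomp Require Import reals exp.

Set Implicit Arguments.
Unset Strict Implicit.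
Unset Printing Implicit Defensive.
Import Order.TTheory GRing.Theory Num.Theory.
Local Open Scope ring_scope.

Definition sumset (D : nat) (A B : {fset 'rV[int]_D}) : {fset 'rV[int]_D} :=
  [fset (a + b)%R | a in A, b in B]%fset.

Definition to_real (R : realType) (D : nat) (x : 'rV[int]_D) : 'rV[R]_D :=
  map_mx intr x.

(* The affine subspace v + V of R^D is represented by the pair (v, V). *)
Definition in_coset (R : realType) (D : nat) (v : 'rV[R]_D)
    (V : {vspace 'rV[R]_D}) (x : 'rV[R]_D) : Prop :=
  x - v \in V.

Definition coset_contains (R : realType) (D : nat) (v : 'rV[R]_D)
    (V : {vspace 'rV[R]_D}) (B : {fset 'rV[int]_D}) : Prop :=
  forall b, b \in B -> in_coset v V (to_real R b).

Definition smallest_coset (R : realType) (D : nat) (v : 'rV[R]_D)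
    (V : {vspace 'rV[R]_D}) (B : {fset 'rV[int]_D}) : Prop :=
  coset_contains v V B /\
  forall (w : 'rV[R]_D) (W : {vspace 'rV[R]_D}), coset_contains w W B ->
    forall x, in_coset v V x -> in_coset w W x.

(* "dim B = d".  There is exactly one such d when B is non-empty (lemmas
   below); for D > 0 there is none when B is empty. *)
Definition has_dim (R : realType) (D : nat) (B : {fset 'rV[int]_D})
    (d : nat) : Prop :=
  exists (v : 'rV[R]_D) (V : {vspace 'rV[R]_D}),
    smallest_coset v V B /\ \dim V = d.

Lemma has_dim_exists (R : realType) (D : nat) (B : {fset 'rV[int]_D}) :
  B != fset0 -> exists d, has_dim R B d.
Proof.
case/fset0Pn=> b0 b0B.
pose s := [seq to_real R b - to_real R b0 | b <- enum_fset B].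
exists (\dim <<s>>%VS), (to_real R b0), <<s>>%VS; split=> //; split.
  by move=> b bB; apply/memv_span/map_f.
move=> w W cW x; rewrite /in_coset => xs.
have sW : (<<s>> <= W)%VS.
  apply/span_subvP=> y /mapP[b bB ->].
  rewrite -(subrKA w) -[w - _]opprB.
  by apply: rpredB; apply: cW.
rewrite -(subrKA (to_real R b0)).
by apply: rpredD; [apply: (subvP sW) | apply: cW].
Qed.

Lemma has_dim_unique (R : realType) (D : nat) (B : {fset 'rV[int]_D})
    (d e : nat) :
  has_dim R B d -> has_dim R B e -> d = e.
Proof.
have le v V w W : @smallest_coset R D v V B -> @smallest_coset R D w W B ->
    (\dim V <= \dim W)%N.
  move=> [_ minV] [cW _]; apply/dimvS/subvP=> u uV.
  have v0 : in_coset w W v by apply: minV cW _ _; rewrite /in_coset subrr mem0v.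
  have vu : in_coset w W (v + u).
    by apply: minV cW _ _; rewrite /in_coset addrC addKr.
  have -> : u = (v + u - w) - (v - w) by rewrite opprB subrKA addrC addKr.
  exact: rpredB.
move=> [v [V [sV <-]]] [w [W [sW <-]]].
by apply/eqP; rewrite eqn_leq (le _ _ _ _ sV sW) (le _ _ _ _ sW sV).
Qed.

(* Main.v *)
(* Write d[X;Y] = H(X + Y) - (H(X) + H(Y))/2 for independent copies of X and Y.

   Over F_2: for X0, Y0 with values in a finite group of exponent 2, minimize
   d[X;Y] + eta (d[X0;X] + d[Y0;Y]).  Comparing a minimizer with sums and fibres of
   independent copies of X and Y bounds two conditional mutual informations by
   O(eta d[X;Y]), and the entropic Balog-Szemeredi-Gowers inequality applied to
   X + Y, X' + Y and X + X' then forces d[X;Y] = 0.  So X is uniform on a coset of a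
   subgroup H, and X0, Y0 have entropy O(d[X0;Y0]) modulo H (Gowers, Green, Manners and
   Tao).

   Over Z: torsion-freeness gives H(X mod 2) <= 4 d[X;Y].  Iterating the F_2 result on
   X mod 2, Y mod 2 yields a linear map psi over F_2 whose kernel has dimension
   O(d[X;Y]) and with H(psi X) + H(psi Y) = O(d[psi X;psi Y]).  If psi = 0, and
   coordinates were chosen such that the sets generate Z^r, then r = O(d[X;Y]).
   Otherwise d decreases on average by at least d[psi X;psi Y] on passing to fibres of
   psi, which pays for the loss in cardinality, and the fibres are strictly smaller. *)
Require Import Defs.
From HB Require Import structures.
From mathcomp Require Import all_boot all_order all_algebra finmap.
From mathcomp Require Import reals exp.
From mathcomp Require boolp classical_sets topology normedtype derive realfun.
From mathcomp Require Import ring lra zify.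

Set Implicit Arguments.
Unset Strict Implicit.
Unset Printing Implicit Defensive.
Import Order.TTheory GRing.Theory Num.Theory.
Local Open Scope ring_scope.

(** * Entropy of functions on a finite probability space *)

Section Entropy.
Variable R : realType.

(** Nearly every entropy inequality here is submodularity ([ent_submod]) for a well-chosen triple of
    variables, combined with [ent_eq], which exchanges tuples carrying the same information; the
    triple is the only thing to be found. Entropies replace cardinalities for two reasons: by the
    chain rule, the average effect of passing to fibres can be computed, and the functional is
    continuous on a compact set of laws, so that an exact minimizer exists. Constants: with [k =
    d[X;Y]], minimality yields [k <= 56 eta k], so [eta = 1/100] is small enough. It gives
    [102 = 1.02 / eta] for the distance to the coset and [204] for each entropy modulo the subgroup.
    The value [1000] leaves room for the iteration over F_2; over Z it is the price, in logarithmic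
    cardinality, of one unit of distance, and ends up as [C1 / 2]. The obstacle over Z is that
    reduction modulo 2 may see nothing, for instance when all points are even. Hence coordinates in
    which the sets generate the whole lattice are chosen afresh before each reduction. *)

Definition pmf (I : finType) (p : I -> R) : Prop :=
  (forall i, 0 <= p i) /\ \sum_i p i = 1.

Definition law (I : finType) (T : eqType) (p : I -> R) (f : I -> T) (t : T) : R :=
  \sum_(i | f i == t) p i.

(** Shannon entropy as an average over the sample space: values may then lie in an infinite type
    such as Z^n, and points of weight 0 contribute 0. *)
Definition ent (I : finType) (T : eqType) (p : I -> R) (f : I -> T) : R :=
  - \sum_i p i * ln (law p f (f i)).

(** Equality at [x], together with the weak inequality at [sqrt x], would give
    [(sqrt x - 1)^2 <= 0]. Strictness is what the equality case of Gibbs' inequality rests on. *)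
Lemma ln_lt_subr1 (x : R) : 0 < x -> x != 1 -> ln x < x - 1.
Proof.
move=> x0 x1; have hx : ln x <= x - 1.
  by have := @le_ln1Dx R (x - 1); rewrite subrKC; apply; lra.
rewrite lt_neqAle hx andbT; apply/eqP => e.
pose y := Num.sqrt x.
have y0 : 0 < y by rewrite sqrtr_gt0.
have yx : y ^+ 2 = x by rewrite sqr_sqrtr // ltW.
have ly : ln y <= y - 1.
  by have := @le_ln1Dx R (y - 1); rewrite subrKC; apply; lra.
move: e; rewrite -yx lnXn // mulr2n => e.
have y1 : y = 1 by apply/eqP; rewrite -subr_eq0 -sqrf_eq0; apply/eqP; nra.
by move: x1; rewrite -yx y1 expr1n eqxx.
Qed.

Lemma ln_le_subr1 (x : R) : 0 < x -> ln x <= x - 1.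
Proof.
by move=> x0; have [->|/(ln_lt_subr1 x0)/ltW//] := eqVneq x 1; rewrite ln1 subrr.
Qed.

(** * Gibbs' inequality and its equality case *)

Section Gibbs.
Variables (T : finType) (p q : T -> R).
Hypotheses (pp : pmf p) (q0 : forall t, 0 <= q t) (q1 : \sum_t q t <= 1).
Hypothesis pq : forall t, 0 < p t -> 0 < q t.

(** Where [p t > 0], [gap t] is nonnegative by [ln u <= u - 1] at [u = q t / p t], with equality
    only for [u = 1]; where [p t = 0] it is [q t]. Summing gives both the inequality and its
    equality case. *)
Let gap t := q t - p t - (p t * ln (q t) - p t * ln (p t)).

Let gap_ge0 t : 0 <= gap t.
Proof.
rewrite /gap; have := pp.1 t; rewrite le_eqVlt => /orP[/eqP<-|p0].
  by rewrite !mul0r !subr0.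
rewrite -mulrBr -ln_div ?posrE ?pq //.
have := ln_le_subr1 (divr_gt0 (pq p0) p0).
rewrite -(ler_pM2l p0) mulrBr mulr1 mulrCA divff ?gt_eqF // mulr1 => h; rewrite subr_ge0; exact: h.
Qed.

Let sum_gap :
  \sum_t gap t = \sum_t q t - 1 - (\sum_t p t * ln (q t) - \sum_t p t * ln (p t)).
Proof. by rewrite !sumrB pp.2. Qed.

Lemma gibbs : \sum_t p t * ln (q t) <= \sum_t p t * ln (p t).
Proof.
have : 0 <= \sum_t gap t by apply: sumr_ge0.
move: q1; rewrite sum_gap => *; lra.
Qed.

Lemma gibbs_eq : \sum_t p t * ln (q t) = \sum_t p t * ln (p t) -> q =1 p.
Proof.
move=> e t; have s0 : \sum_t gap t = 0.
  apply/eqP; rewrite eq_le; apply/andP; split; last exact: sumr_ge0.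
  move: q1; rewrite sum_gap e => *; lra.
have /eqP : gap t = 0 := psumr_eq0P (fun t _ => gap_ge0 t) s0 isT.
rewrite /gap; have := pp.1 t; rewrite le_eqVlt => /orP[/eqP<-|p0].
  by rewrite !mul0r !subr0 => /eqP.
have [e1 _|ne] := eqVneq (q t / p t) 1.
  by rewrite -[q t](@divfK _ (p t)) ?gt_eqF // e1 mul1r.
have lt := ln_lt_subr1 (divr_gt0 (pq p0) p0) ne.
move: lt; rewrite ln_div ?posrE ?pq // -(ltr_pM2l p0) !mulrBr mulr1 mulrCA divff ?(gt_eqF p0) //.
by rewrite mulr1 => lt /eqP e0; exfalso; lra.
Qed.

End Gibbs.

Lemma law_ge0 (I : finType) (T : eqType) (p : I -> R) (f : I -> T) t :
  pmf p -> 0 <= law p f t.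
Proof. by move=> [p0 _]; apply: sumr_ge0. Qed.

Lemma law_ge (I : finType) (T : eqType) (p : I -> R) (f : I -> T) i :
  pmf p -> p i <= law p f (f i).
Proof.
move=> [p0 _]; rewrite /law (bigD1 i) //= lerDl; exact: sumr_ge0.
Qed.

Lemma law_gt0 (I : finType) (T : eqType) (p : I -> R) (f : I -> T) i :
  pmf p -> 0 < p i -> 0 < law p f (f i).
Proof. by move=> pp /lt_le_trans; apply; apply: law_ge. Qed.

Lemma law_le1 (I : finType) (T : eqType) (p : I -> R) (f : I -> T) t :
  pmf p -> law p f t <= 1.
Proof.
move=> [p0 <-]; rewrite /law [leRHS](bigID (fun i => f i == t)) /= lerDl.
exact: sumr_ge0.
Qed.

Lemma pmf_law (I T : finType) (p : I -> R) (f : I -> T) : pmf p -> pmf (law p f).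
Proof.
move=> pp; split=> [t|]; first exact: law_ge0.
by rewrite -pp.2 (partition_big f predT).
Qed.

Lemma sum_law (I T : finType) (p : I -> R) (f : I -> T) (F : T -> R) :
  \sum_i p i * F (f i) = \sum_t law p f t * F t.
Proof.
rewrite (partition_big f predT) //; apply: eq_bigr => t _.
by rewrite /law mulr_suml; apply: eq_bigr => i /eqP->.
Qed.

Lemma law_comp (I T : finType) (S : eqType) (p : I -> R) (f : I -> T) (g : T -> S) :
  law p (g \o f) =1 law (law p f) g.
Proof.
move=> s; rewrite /law (partition_big f (fun t => g t == s)) //=.
apply: eq_bigr => t /eqP gt; apply: eq_bigl => i.
by have [->|] := eqVneq (f i) t; rewrite ?andbF // gt eqxx.
Qed.

Lemma ent_comp (I T : finType) (S : eqType) (p : I -> R) (f : I -> T) (g : T -> S) :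
  ent p (g \o f) = ent (law p f) g.
Proof.
rewrite /ent -(sum_law p f (fun t => ln (law (law p f) g (g t)))); congr (- _); apply: eq_bigr => i _.
by rewrite law_comp.
Qed.

Lemma law_id (I : finType) (p : I -> R) : law p id =1 p.
Proof. by move=> i; rewrite /law big_pred1_eq. Qed.

Lemma entE (I T : finType) (p : I -> R) (f : I -> T) :
  ent p f = - \sum_t law p f t * ln (law p f t).
Proof. by rewrite /ent (sum_law p f (fun t => ln (law p f t))). Qed.

Lemma eq_law (I : finType) (T : eqType) (p q : I -> R) (f g : I -> T) :
  p =1 q -> f =1 g -> law p f =1 law q g.
Proof. by move=> pq fg t; apply: eq_big => i; rewrite ?fg. Qed.

Lemma eq_ent (I : finType) (T : eqType) (p q : I -> R) (f g : I -> T) :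
  p =1 q -> f =1 g -> ent p f = ent q g.
Proof.
move=> pq fg; congr (- _); apply: eq_bigr => i _.
by rewrite (eq_law pq fg) fg pq.
Qed.

Lemma ent_bij (I J : finType) (T : eqType) (p : I -> R) (q : J -> R) (h : I -> J)
    (f : J -> T) :
  bijective h -> (forall i, p i = q (h i)) -> ent p (f \o h) = ent q f.
Proof.
move=> bh pq; congr (- _); rewrite [RHS](reindex h) /=; last exact: onW_bij.
apply: eq_bigr => i _; rewrite pq; congr (_ * ln _).
rewrite /law [RHS](reindex h) /=; last exact: onW_bij.
by apply: eq_bigr => j _; rewrite pq.
Qed.

(** * Shannon inequalities for variables on one space *)

Section SameSpace.
Variables (I : finType) (p : I -> R).
Hypothesis pp : pmf p.

Lemma pmf_gt0 i : p i != 0 -> 0 < p i.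
Proof. by rewrite lt_neqAle eq_sym pp.1 andbT. Qed.

(** Points of weight 0 are exempt, so that under a uniform law on a subset one variable need
    determine another only on that subset. *)
Lemma ent_le (T S : eqType) (f : I -> T) (g : I -> S) :
  (forall i j, p i != 0 -> p j != 0 -> f i = f j -> g i = g j) ->
  ent p g <= ent p f.
Proof.
move=> fg; rewrite /ent lerN2; apply: ler_sum => i _.
have [->|pi0] := eqVneq (p i) 0; first by rewrite !mul0r.
apply: ler_wpM2l; first exact: pp.1.
rewrite ler_ln ?posrE ?law_gt0 ?pmf_gt0 //.
rewrite /law [leLHS]big_mkcond [leRHS]big_mkcond; apply: ler_sum => j _.
case: eqP => [e|_]; last by case: ifP => // _; apply: pp.1.
have [->|pj0] := eqVneq (p j) 0; first by rewrite if_same.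
by rewrite (fg j i) ?eqxx.
Qed.

Lemma ent_eq (T S : eqType) (f : I -> T) (g : I -> S) :
  (forall i j, p i != 0 -> p j != 0 -> f i = f j -> g i = g j) ->
  (forall i j, p i != 0 -> p j != 0 -> g i = g j -> f i = f j) ->
  ent p f = ent p g.
Proof. by move=> fg gf; apply/eqP; rewrite eq_le !ent_le. Qed.

Lemma ent_eqb (T S : eqType) (f : I -> T) (g : I -> S) :
  (forall i j, (f i == f j) = (g i == g j)) -> ent p f = ent p g.
Proof.
by move=> fg; apply: ent_eq => i j _ _ /eqP e; apply/eqP; rewrite ?fg // -fg.
Qed.

Lemma ent_ge0 (T : eqType) (f : I -> T) : 0 <= ent p f.
Proof.
rewrite oppr_ge0; apply: sumr_le0 => i _.
by apply: mulr_ge0_le0; [exact: pp.1 | apply: ln_le0; exact: law_le1].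
Qed.

(* Replacing f by a choice of representatives of its fibres reduces statements
   about eqType-valued f to finType-valued ones. *)
Let rep (T : eqType) (f : I -> T) (i : I) : I := odflt i [pick j | f j == f i].

Let repE (T : eqType) (f : I -> T) i j : (rep f i == rep f j) = (f i == f j).
Proof.
have fr k : f (rep f k) = f k.
  by rewrite /rep; case: pickP => //= l /eqP.
apply/eqP/eqP => [e|e]; first by rewrite -(fr i) e fr.
rewrite /rep (eq_pick (_ : _ =1 (fun k => f k == f j))); last by move=> k; rewrite e.
by case: pickP => // /(_ j); rewrite eqxx.
Qed.

(** Gibbs' inequality against [a b / c], the law that makes [f] and [g] independent given [h] while
    keeping the laws of [(f, h)] and [(g, h)]. *)
Let submod_fin (A B C : finType) (f : I -> A) (g : I -> B) (h : I -> C) :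
  ent p (fun i => (f i, g i, h i)) + ent p h <=
  ent p (fun i => (f i, h i)) + ent p (fun i => (g i, h i)).
Proof.
pose fgh i := (f i, g i, h i).
pose P := law p fgh.
pose a := law p (fun i => (f i, h i)); pose b := law p (fun i => (g i, h i)).
pose c := law p h.
pose q (t : A * B * C) := a (t.1.1, t.2) * b (t.1.2, t.2) / c t.2.
have q0 t : 0 <= q t by rewrite /q divr_ge0 ?mulr_ge0 // law_ge0.
have a1 z : \sum_x a (x, z) = c z.
  rewrite /c /law (partition_big f predT) //; apply: eq_bigr => x _.
  by apply: eq_bigl => i; rewrite xpair_eqE andbC.
have b1 z : \sum_x b (x, z) = c z.
  rewrite /c /law (partition_big g predT) //; apply: eq_bigr => x _.
  by apply: eq_bigl => i; rewrite xpair_eqE andbC.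
have q1 : \sum_t q t <= 1.
  have -> : \sum_t q t = \sum_z \sum_x \sum_y a (x, z) * b (y, z) / c z.
    rewrite (eq_bigr (fun t => q (t.1, t.2))); last by case.
    rewrite -(pair_bigA _ (fun xy z => q (xy, z))) /= exchange_big /=.
    by apply: eq_bigr => z _; rewrite pair_bigA.
  rewrite -(pmf_law h pp).2; apply: ler_sum => z _.
  under eq_bigr do rewrite -mulr_suml -mulr_sumr b1.
  rewrite -!mulr_suml a1 -/(c z).
  have [->|c0] := eqVneq (c z) 0; first by rewrite !mul0r.
  by rewrite mulfK.
have supp t : 0 < P t -> exists2 i, 0 < p i & fgh i = t.
  move=> Pt; have : P t != 0 by rewrite gt_eqF.
  rewrite /P /law psumr_neq0 => [/hasP[i _ /andP[/eqP e pi]]|i _]; last exact: pp.1.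
  by exists i.
have pq t : 0 < P t -> 0 < q t.
  move=> /supp[i pi <-]; rewrite /q /= divr_gt0 ?mulr_gt0 //.
  - exact: (law_gt0 (fun i => (f i, h i))).
  - exact: (law_gt0 (fun i => (g i, h i))).
  - exact: law_gt0.
have := gibbs (pmf_law fgh pp) q0 q1 pq.
rewrite -!sum_law -/P /ent -/P -/a -/b -/c => G.
have e : \sum_i p i * ln (q (fgh i)) = \sum_i p i * ln (a (f i, h i))
   + \sum_i p i * ln (b (g i, h i)) - \sum_i p i * ln (c (h i)).
  rewrite -big_split /= -sumrB; apply: eq_bigr => i _.
  have [->|/pmf_gt0 pi] := eqVneq (p i) 0; first by rewrite !mul0r addr0 subr0.
  have a0 : 0 < a (f i, h i) by exact: (law_gt0 (fun i => (f i, h i))).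
  have b0 : 0 < b (g i, h i) by exact: (law_gt0 (fun i => (g i, h i))).
  have c0 : 0 < c (h i) by exact: law_gt0.
  by rewrite /q /= ln_div ?lnM ?posrE ?mulr_gt0 // mulrBr mulrDr.
move: G; rewrite e /fgh => ?; lra.
Qed.

Lemma ent_submod (A B C : eqType) (f : I -> A) (g : I -> B) (h : I -> C) :
  ent p (fun i => (f i, g i, h i)) + ent p h <=
  ent p (fun i => (f i, h i)) + ent p (fun i => (g i, h i)).
Proof.
have := submod_fin (rep f) (rep g) (rep h).
rewrite (@ent_eqb _ _ _ (fun i => (f i, g i, h i))); last first.
  by move=> i j; rewrite !xpair_eqE !repE.
rewrite (@ent_eqb _ _ (fun i => (rep f i, rep h i)) (fun i => (f i, h i))); last first.
  by move=> i j; rewrite !xpair_eqE !repE.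
rewrite (@ent_eqb _ _ (fun i => (rep g i, rep h i)) (fun i => (g i, h i))); last first.
  by move=> i j; rewrite !xpair_eqE !repE.
by rewrite (ent_eqb (repE h)).
Qed.

Lemma ent_const (T : eqType) (f : I -> T) :
  (forall i j, p i != 0 -> p j != 0 -> f i = f j) -> ent p f = 0.
Proof.
move=> cf; rewrite (@ent_eq _ _ _ (fun=> tt)) //; last first.
  by move=> i j pi pj _; apply: cf.
rewrite entE; apply/eqP; rewrite oppr_eq0 big1 // => -[] _.
by rewrite /law (eq_bigl predT) // pp.2 ln1 mulr0.
Qed.

Lemma ent_pair_le (A B : eqType) (f : I -> A) (g : I -> B) :
  ent p (fun i => (f i, g i)) <= ent p f + ent p g.
Proof.
have := ent_submod f g (fun=> tt).
rewrite (@ent_const _ (fun=> tt)) // addr0.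
rewrite (@ent_eqb _ _ _ (fun i => (f i, g i))); last first.
  by move=> i j; rewrite [LHS]xpair_eqE andbT.
rewrite (@ent_eqb _ _ (fun i => (f i, tt)) f); last by move=> i j; rewrite xpair_eqE andbT.
by rewrite (@ent_eqb _ _ (fun i => (g i, tt)) g) // => i j; rewrite xpair_eqE andbT.
Qed.

End SameSpace.

End Entropy.

(** * Products and conditioning *)

Definition prodp (R : realType) (I J : finType) (p : I -> R) (q : J -> R)
  (x : I * J) : R := p x.1 * q x.2.

Local Notation "p \ox q" := (prodp p q) (at level 40, left associativity).

(** Conditioning stays on the full sample space, so no subtypes arise. If [Z = z] has weight 0 the
    result is the zero function, which averages multiply by that weight. *)
Definition cond (R : realType) (I : finType) (T : eqType) (p : I -> R) (Z : I -> T)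
  (z : T) (i : I) : R := if Z i == z then p i / law p Z z else 0.

Section Products.
Variable R : realType.
Implicit Types I J K : finType.

Lemma pmf_prod I J (p : I -> R) (q : J -> R) : pmf p -> pmf q -> pmf (p \ox q).
Proof.
move=> [p0 p1] [q0 q1]; split=> [x|]; first exact: mulr_ge0.
rewrite /prodp -(pair_bigA _ (fun i j => p i * q j)) /=.
by under eq_bigr do rewrite -mulr_sumr q1 mulr1.
Qed.

Lemma law_prod I J (S T : eqType) (p : I -> R) (q : J -> R) (f : I -> S) (g : J -> T)
    s t :
  law (p \ox q) (fun x => (f x.1, g x.2)) (s, t) = law p f s * law q g t.
Proof.
rewrite /law /prodp big_distrlr pair_big /=.
by apply: eq_bigl => x; rewrite xpair_eqE.
Qed.

Lemma law_fst I J (p : I -> R) (q : J -> R) : pmf q -> law (p \ox q) fst =1 p.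
Proof.
move=> [_ q1] i; rewrite /law /prodp -[RHS]mulr1 -q1 mulr_sumr.
rewrite -(@big_pred1_eq _ 0 +%R _ i (fun i => \sum_j p i * q j)) pair_big /=.
by apply: eq_bigl => x; rewrite andbT.
Qed.

Lemma law_snd I J (p : I -> R) (q : J -> R) : pmf p -> law (p \ox q) snd =1 q.
Proof.
move=> [_ p1] j; rewrite /law /prodp -[RHS]mul1r -p1 mulr_suml.
under [RHS]eq_bigr do rewrite -(@big_pred1_eq _ 0 +%R _ j (fun j => p _ * q j)).
by rewrite pair_big /=.
Qed.

Lemma ent_prod_map I J I' J' (T : eqType) (p : I -> R) (q : J -> R) (p' : I' -> R)
    (q' : J' -> R) (u : I -> I') (v : J -> J') (F : I' * J' -> T) :
  law p u =1 p' -> law q v =1 q' ->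
  ent (p \ox q) (fun x => F (u x.1, v x.2)) = ent (p' \ox q') F.
Proof.
move=> pu qv; rewrite -[LHS]/(ent (p \ox q) (F \o (fun x => (u x.1, v x.2)))).
rewrite ent_comp; apply: eq_ent => // -[i j].
by rewrite law_prod pu qv.
Qed.

Lemma ent_fst I J (T : eqType) (p : I -> R) (q : J -> R) (f : I -> T) :
  pmf q -> ent (p \ox q) (fun x => f x.1) = ent p f.
Proof.
move=> pq; rewrite -[LHS]/(ent (p \ox q) (f \o fst)) ent_comp.
by apply: eq_ent => //; apply: law_fst.
Qed.

Lemma ent_snd I J (T : eqType) (p : I -> R) (q : J -> R) (f : J -> T) :
  pmf p -> ent (p \ox q) (fun x => f x.2) = ent q f.
Proof.
move=> pp; rewrite -[LHS]/(ent (p \ox q) (f \o snd)) ent_comp.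
by apply: eq_ent => //; apply: law_snd.
Qed.

Lemma ent_swap I J (T : eqType) (p : I -> R) (q : J -> R) (f : J * I -> T) :
  ent (p \ox q) (fun x => f (x.2, x.1)) = ent (q \ox p) f.
Proof.
rewrite -[LHS]/(ent _ (f \o (fun x => (x.2, x.1)))).
apply: ent_bij; first by exists (fun x => (x.2, x.1)); case.
by move=> x; rewrite /prodp mulrC.
Qed.

Lemma ent_prod I J (S T : eqType) (p : I -> R) (q : J -> R) (f : I -> S) (g : J -> T) :
  pmf p -> pmf q -> ent (p \ox q) (fun x => (f x.1, g x.2)) = ent p f + ent q g.
Proof.
move=> pp pq; rewrite -(ent_fst p f pq) -(ent_snd q g pp) /ent -opprD -big_split /=.
congr (- _); apply: eq_bigr => -[i j] _ /=.
rewrite law_prod -mulrDr.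
have [->|/(pmf_gt0 (pmf_prod pp pq))] := eqVneq ((p \ox q) (i, j)) 0.
  by rewrite !mul0r.
rewrite /prodp /= => pij.
have pi : 0 < p i.
  by rewrite (pmf_gt0 pp) //; apply: contraTneq pij => ->; rewrite mul0r ltxx.
have qj : 0 < q j.
  by rewrite (pmf_gt0 pq) //; apply: contraTneq pij => ->; rewrite mulr0 ltxx.
rewrite lnM ?posrE ?law_gt0 //; congr (_ * (ln _ + ln _)).
  rewrite -[RHS]/(law (p \ox q) (f \o fst) (f i)) [RHS]law_comp.
  by apply: eq_law => // k; rewrite law_fst.
rewrite -[RHS]/(law (p \ox q) (g \o snd) (g j)) [RHS]law_comp.
by apply: eq_law => // k; rewrite law_snd.
Qed.

Lemma pmf_cond I (T : eqType) (p : I -> R) (Z : I -> T) z :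
  pmf p -> law p Z z != 0 -> pmf (cond p Z z).
Proof.
move=> pp z0; split=> [i|].
  by rewrite /cond; case: ifP => // _; rewrite divr_ge0 ?law_ge0 ?pp.1.
by rewrite -big_mkcond /= -mulr_suml divff.
Qed.

Lemma ent_chain I (A : eqType) (T : finType) (p : I -> R) (f : I -> A) (Z : I -> T) :
  pmf p -> ent p (fun i => (f i, Z i)) =
           ent p Z + \sum_z law p Z z * ent (cond p Z z) f.
Proof.
move=> pp; have step z : law p Z z * ent (cond p Z z) f =
    - \sum_(i | Z i == z) p i * ln (law (cond p Z (Z i)) f (f i)).
  rewrite /ent mulrN mulr_sumr [in RHS]big_mkcond; congr (- _).
  apply: eq_bigr => i _; rewrite {1}/cond; case: eqP => [e|_]; last first.
    by rewrite mul0r mulr0.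
  rewrite e.
  have [z0|z0] := eqVneq (law p Z z) 0; last by rewrite mulrA [_ * (_ / _)]mulrC divfK.
  have pi0 : p i = 0.
    by apply/eqP; rewrite eq_le pp.1 -z0 -{1}e law_ge.
  by rewrite pi0 z0 !mul0r.
under eq_bigr do rewrite step.
rewrite sumrN -opprD /ent; congr (- _).
pose G i := p i * ln (law (cond p Z (Z i)) f (f i)).
have <- : \sum_i G i = \sum_z \sum_(i | Z i == z) G i.
  by rewrite (partition_big Z predT).
rewrite -big_split /=; apply: eq_bigr => i _; rewrite /G.
have [->|/(pmf_gt0 pp) pi] := eqVneq (p i) 0; first by rewrite !mul0r addr0.
have z0 : 0 < law p Z (Z i) by exact: law_gt0.
have e : law p (fun i => (f i, Z i)) (f i, Z i) =
    law p Z (Z i) * law (cond p Z (Z i)) f (f i).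
  rewrite /law mulr_sumr big_mkcond [RHS]big_mkcond; apply: eq_bigr => j _.
  rewrite xpair_eqE /cond; case: eqP => //= _; case: eqP => _; last by rewrite mulr0.
  by rewrite mulrCA divff ?mulr1 ?gt_eqF.
have c0 : 0 < law (cond p Z (Z i)) f (f i).
  by rewrite -(pmulr_rgt0 _ z0) -e (law_gt0 (fun i => (f i, Z i))).
by rewrite e lnM ?posrE // mulrDr.
Qed.

End Products.

#[local] Hint Resolve pmf_prod : core.

(** * Entropic Ruzsa distance *)

(** The usual Ruzsa distance has a difference where this has a sum. The sum is what [A + A]
    controls, and in exponent 2 the two agree; in general the triangle inequality turns sums into a
    difference. *)
Definition rd (R : realType) (I J : finType) (G : zmodType) (p : I -> R) (f : I -> G)
    (q : J -> R) (g : J -> G) : R :=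
  ent (p \ox q) (fun x => f x.1 + g x.2) - (ent p f + ent q g) / 2.

Section Sums.
Variables (R : realType) (G : zmodType).
Implicit Types I J K : finType.

Lemma eq_rd I J (p p' : I -> R) (f f' : I -> G) (q q' : J -> R) (g g' : J -> G) :
  p =1 p' -> f =1 f' -> q =1 q' -> g =1 g' -> rd p f q g = rd p' f' q' g'.
Proof.
move=> pp ff qq gg; rewrite /rd (eq_ent pp ff) (eq_ent qq gg).
by congr (_ - _); apply: eq_ent => x; rewrite /prodp ?pp ?qq ?ff ?gg.
Qed.

Lemma ent_addC I J (p : I -> R) (f : I -> G) (q : J -> R) (g : J -> G) :
  ent (p \ox q) (fun x => f x.1 + g x.2) = ent (q \ox p) (fun x => g x.1 + f x.2).
Proof.
rewrite -ent_swap; apply: eq_ent => // x /=; exact: addrC.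
Qed.

Lemma rdC I J (p : I -> R) (f : I -> G) (q : J -> R) (g : J -> G) :
  rd p f q g = rd q g p f.
Proof. by rewrite /rd ent_addC [ent p f + _]addrC. Qed.

Lemma ent_add_ge I J (p : I -> R) (f : I -> G) (q : J -> R) (g : J -> G) :
  pmf p -> pmf q -> ent p f <= ent (p \ox q) (fun x => f x.1 + g x.2).
Proof.
move=> pp pq; have pw := pmf_prod pp pq.
have := ent_pair_le pw (fun x => f x.1 + g x.2) (fun x => g x.2).
rewrite (ent_snd _ _ pp).
rewrite (@ent_eq _ _ _ pw _ _ _ (fun x => (f x.1, g x.2))).
- rewrite ent_prod // => ?; lra.
- by move=> i j _ _ [e1 e2]; move: e1; rewrite e2 => /addIr->.
- by move=> i j _ _ [-> ->].
Qed.

Lemma rd_ge I J (p : I -> R) (f : I -> G) (q : J -> R) (g : J -> G) :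
  pmf p -> pmf q -> ent p f - ent q g <= 2 * rd p f q g.
Proof.
move=> pp pq; have := ent_add_ge f g pp pq; rewrite /rd => ?; lra.
Qed.

Lemma rd_ge0 I J (p : I -> R) (f : I -> G) (q : J -> R) (g : J -> G) :
  pmf p -> pmf q -> 0 <= rd p f q g.
Proof.
move=> pp pq; have := rd_ge f g pp pq; have := rd_ge g f pq pp.
rewrite (rdC q) => ? ?; lra.
Qed.

(** * Sumset inequalities for three independent variables *)

Section Triple.
Variables (I J K : finType) (p : I -> R) (q : J -> R) (r : K -> R).
Variables (f : I -> G) (g : J -> G) (h : K -> G).
Hypotheses (pp : pmf p) (pq : pmf q) (pr : pmf r).

Let w := p \ox q \ox r.
Let pw : pmf w. Proof. by apply: pmf_prod => //; apply: pmf_prod. Qed.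

Lemma ent_triple12 (T : eqType) (F : I * J -> T) :
  ent w (fun x => F x.1) = ent (p \ox q) F.
Proof. exact: ent_fst. Qed.

Lemma ent_triple23 (T : eqType) (F : J * K -> T) :
  ent w (fun x => F (x.1.2, x.2)) = ent (q \ox r) F.
Proof.
by apply: (@ent_prod_map _ _ _ _ _ _ _ _ _ _ snd id); [apply: law_snd|apply: law_id].
Qed.

Lemma ent_triple13 (T : eqType) (F : I * K -> T) :
  ent w (fun x => F (x.1.1, x.2)) = ent (p \ox r) F.
Proof.
by apply: (@ent_prod_map _ _ _ _ _ _ _ _ _ _ fst id); [apply: law_fst|apply: law_id].
Qed.

(** Submodularity for X and Z given X + Y + Z: with the total, X amounts to the independent pair (X,
    Y + Z), and Z to (X + Y, Z). *)
Lemma kaimanovich_vershik :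
  ent w (fun x => f x.1.1 + g x.1.2 + h x.2) + ent q g <=
  ent (p \ox q) (fun x => f x.1 + g x.2) + ent (q \ox r) (fun x => g x.1 + h x.2).
Proof.
have := ent_submod pw (fun x => f x.1.1) (fun x => h x.2)
  (fun x => f x.1.1 + g x.1.2 + h x.2).
rewrite (@ent_eq _ _ _ pw _ _ _ (fun x => ((f x.1.1, g x.1.2), h x.2))); first last.
- by move=> i j _ _ [-> -> ->].
- by move=> i j _ _ [-> ->] /addIr/addrI->.
rewrite (@ent_eq _ _ _ pw _ _ (fun x => (f x.1.1, f x.1.1 + g x.1.2 + h x.2))
   (fun x => (f x.1.1, g x.1.2 + h x.2))); first last.
- by move=> i j _ _ [-> e]; rewrite -!addrA e.
- by move=> i j _ _ [->]; rewrite -!addrA => /addrI->.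
rewrite (@ent_eq _ _ _ pw _ _ (fun x => (h x.2, f x.1.1 + g x.1.2 + h x.2))
   (fun x => (f x.1.1 + g x.1.2, h x.2))); first last.
- by move=> i j _ _ [-> ->].
- by move=> i j _ _ [->] /addIr->.
rewrite (@ent_prod _ _ _ _ _ (p \ox q) r (fun x => (f x.1, g x.2)) h) //; last first.
  exact: pmf_prod.
rewrite (@ent_prod _ _ _ _ _ (p \ox q) r (fun x => f x.1 + g x.2) h) //; last first.
  exact: pmf_prod.
rewrite ent_prod //.
have := ent_pair_le pw (fun x => f x.1.1) (fun x => g x.1.2 + h x.2).
rewrite (ent_triple12 (fun x => f x.1)) (ent_triple23 (fun x => g x.1 + h x.2)).
rewrite ent_fst // => ? ?; lra.
Qed.

(** Submodularity for X and X + Y given X - Z: the pair (X + Y, X - Z) carries the same information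
    as (X + Y, Y + Z). *)
Lemma ent_sub_triangle :
  ent (p \ox r) (fun x => f x.1 - h x.2) + ent q g <=
  ent (p \ox q) (fun x => f x.1 + g x.2) + ent (q \ox r) (fun x => g x.1 + h x.2).
Proof.
have := ent_submod pw (fun x => f x.1.1) (fun x => f x.1.1 + g x.1.2)
  (fun x => f x.1.1 - h x.2).
rewrite (@ent_eq _ _ _ pw _ _ _ (fun x => ((f x.1.1, g x.1.2), h x.2))); first last.
- by move=> i j _ _ [-> -> ->].
- by move=> i j _ _ [-> /addrI-> /addrI/oppr_inj->].
rewrite (@ent_eq _ _ _ pw _ _ (fun x => (f x.1.1, f x.1.1 - h x.2))
   (fun x => (f x.1.1, h x.2))); first last.
- by move=> i j _ _ [-> ->].
- by move=> i j _ _ [-> /addrI/oppr_inj->].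
rewrite (@ent_eq _ _ _ pw _ _ (fun x => (f x.1.1 + g x.1.2, f x.1.1 - h x.2))
   (fun x => (f x.1.1 + g x.1.2, g x.1.2 + h x.2))); first last.
- move=> i j _ _ [e1 e2]; congr pair => //.
  by rewrite -[f i.1.1](addrK (g i.1.2)) e1 -[f j.1.1 in RHS](addrK (g j.1.2))
    -!addrA -!opprD e2.
- move=> i j _ _ [e1 e2]; congr pair => //.
  have e (u v x : G) : v + x = (u + v) - (u - x).
    by rewrite opprB [u + v]addrC -addrA [u + _]addrC subrK.
  by rewrite (e (f i.1.1)) e1 e2 -e.
rewrite (@ent_prod _ _ _ _ _ (p \ox q) r (fun x => (f x.1, g x.2)) h) //; last first.
  exact: pmf_prod.
rewrite ent_prod // (ent_triple13 (fun x => f x.1 - h x.2)).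
rewrite (ent_triple13 (fun x => (f x.1, h x.2))) ent_prod //.
have := ent_pair_le pw (fun x => f x.1.1 + g x.1.2) (fun x => g x.1.2 + h x.2).
rewrite (ent_triple12 (fun x => f x.1 + g x.2)) (ent_triple23 (fun x => g x.1 + h x.2)).
by move=> ? ?; lra.
Qed.

End Triple.

Section Average.
Variables (I J : finType) (S T : finType) (p : I -> R) (q : J -> R).
Variables (f : I -> G) (g : J -> G) (Z : I -> S) (W : J -> T).
Hypotheses (pp : pmf p) (pq : pmf q).

Lemma cond_prod z w : cond p Z z \ox cond q W w =1
  cond (p \ox q) (fun x => (Z x.1, W x.2)) (z, w).
Proof.
move=> x; rewrite /cond /prodp law_prod xpair_eqE.
case: eqP => _ /=; last by rewrite mul0r.
by case: eqP => _; rewrite ?mulr0 // invfM mulrACA.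
Qed.

(** Given [Z] and [W] the two variables remain independent, so the chain rule computes the average
    exactly; all bounds on fibres over independent conditions are read off from this formula. *)
Lemma avg_rd :
  \sum_z \sum_w law p Z z * law q W w * rd (cond p Z z) f (cond q W w) g =
  ent (p \ox q) (fun x => (f x.1 + g x.2, (Z x.1, W x.2))) - ent p Z - ent q W
  - (ent p (fun i => (f i, Z i)) - ent p Z + ent q (fun j => (g j, W j)) - ent q W) / 2.
Proof.
have [_ sZ] := pmf_law Z pp; have [_ sW] := pmf_law W pq.
rewrite (ent_chain f Z pp) (ent_chain g W pq).
rewrite (ent_chain (fun x => f x.1 + g x.2) (fun x => (Z x.1, W x.2))); last first.
  exact: pmf_prod.
rewrite ent_prod //.
pose a z w := law p Z z * law q W w *
  ent (cond p Z z \ox cond q W w) (fun x => f x.1 + g x.2).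
have -> : \sum_x law (p \ox q) (fun x => (Z x.1, W x.2)) x *
    ent (cond (p \ox q) (fun x => (Z x.1, W x.2)) x) (fun x => f x.1 + g x.2) =
    \sum_z \sum_w a z w.
  rewrite pair_bigA; apply: eq_bigr => -[z w] _; rewrite law_prod /a.
  by congr (_ * _); apply: eq_ent => // x; rewrite cond_prod.
set b := fun z => law p Z z * ent (cond p Z z) f.
set c := fun w => law q W w * ent (cond q W w) g.
have -> : \sum_z b z = \sum_z \sum_w law q W w * b z.
  by apply: eq_bigr => z _; rewrite -mulr_suml sW mul1r.
have -> : \sum_w c w = \sum_z \sum_w law p Z z * c w.
  rewrite exchange_big /=.
  by apply: eq_bigr => w _; rewrite -mulr_suml sZ mul1r.
have -> : \sum_z \sum_w law p Z z * law q W w * rd (cond p Z z) f (cond q W w) g =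
  \sum_z \sum_w a z w
  - (\sum_z \sum_w law q W w * b z + \sum_z \sum_w law p Z z * c w) / 2.
  rewrite -big_split /= mulr_suml -sumrB; apply: eq_bigr => z _.
  rewrite -big_split /= mulr_suml -sumrB; apply: eq_bigr => w _.
  by rewrite /a /b /c /rd; ring.
by ring.
Qed.

End Average.

Lemma avg_rd_r I J (T : finType) (p : I -> R) (f : I -> G) (q : J -> R) (g : J -> G)
    (W : J -> T) : pmf p -> pmf q ->
  \sum_w law q W w * rd p f (cond q W w) g <=
  ent (p \ox q) (fun x => f x.1 + g x.2)
  - (ent p f + ent q (fun j => (g j, W j)) - ent q W) / 2.
Proof.
move=> pp pq; have pw := pmf_prod pp pq.
have l1 : law p (fun=> tt) tt = 1.
  by rewrite /law (eq_bigl predT) // pp.2.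
have := avg_rd f g (fun=> tt) W pp pq.
rewrite (@ent_const _ _ _ pp _ (fun=> tt)) //.
rewrite (@ent_eq _ _ _ pp _ _ (fun i => (f i, tt)) f); first last.
- by move=> i j _ _ ->.
- by move=> i j _ _ [].
rewrite (big_pred1 tt); last by case.
rewrite (eq_bigr (fun w => law q W w * rd p f (cond q W w) g)); last first.
  move=> w _; rewrite l1 mul1r; congr (_ * _); apply: eq_rd => // i.
  by rewrite /cond l1 divr1.
have := ent_pair_le pw (fun x => f x.1 + g x.2) (fun x => (tt, W x.2)).
rewrite (@ent_eq _ _ _ pw _ _ (fun x => (tt, W x.2)) (fun x => W x.2)); first last.
- by move=> i j _ _ ->.
- by move=> i j _ _ [].
rewrite (ent_snd _ _ pp) => *; lra.
Qed.

End Sums.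

(** * The entropic Balog-Szemeredi-Gowers inequality *)

Section Coupling.
Variables (R : realType) (I T : finType) (p : I -> R) (Z : I -> T).
Hypothesis pp : pmf p.

(* Two copies of p, conditionally independent given Z. *)
Definition coupling (x : I * I) : R :=
  if Z x.1 == Z x.2 then p x.1 * p x.2 / law p Z (Z x.1) else 0.

Lemma coupling_swap x : coupling (x.2, x.1) = coupling x.
Proof.
rewrite /coupling /= eq_sym [p x.2 * _]mulrC.
by case: eqP => // ->.
Qed.

Lemma law_coupling_fst : law coupling fst =1 p.
Proof.
move=> i; rewrite /law.
transitivity (\sum_(i' | i' == i) \sum_(j | Z i' == Z j) p i' * p j / law p Z (Z i')).
  rewrite [RHS](eq_bigr (fun i' => \sum_j coupling (i', j))); last first.
    by move=> i' _; rewrite big_mkcond.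
  by rewrite pair_big; apply: eq_big => -[i1 j1] //=; rewrite andbT.
rewrite big_pred1_eq.
have [->|pi] := eqVneq (p i) 0; first by apply: big1 => j _; rewrite !mul0r.
under eq_bigr do rewrite -mulrA mulrC -mulrA.
rewrite -mulr_suml (eq_bigl (fun j => Z j == Z i)); last by move=> j; rewrite eq_sym.
rewrite -/(law p Z (Z i)) mulrA divff ?mul1r // gt_eqF // law_gt0 //.
exact: pmf_gt0.
Qed.

Lemma pmf_coupling : pmf coupling.
Proof.
split=> [x|].
  by rewrite /coupling; case: ifP => // _; rewrite divr_ge0 ?law_ge0 ?mulr_ge0 ?pp.1.
rewrite (partition_big fst predT) //= -pp.2; apply: eq_bigr => i _.
by rewrite -[RHS]law_coupling_fst.
Qed.

Lemma ent_coupling_fst (A : eqType) (f : I -> A) :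
  ent coupling (fun x => f x.1) = ent p f.
Proof.
rewrite -[LHS]/(ent coupling (f \o fst)) ent_comp.
by apply: eq_ent => //; apply: law_coupling_fst.
Qed.

Lemma ent_coupling_swap (A : eqType) (F : I * I -> A) :
  ent coupling (fun x => F (x.2, x.1)) = ent coupling F.
Proof.
rewrite -[LHS]/(ent _ (F \o (fun x => (x.2, x.1)))).
apply: ent_bij; first by exists (fun x => (x.2, x.1)); case.
by move=> x; rewrite coupling_swap.
Qed.

Lemma cond_coupling z :
  cond coupling (fun x => Z x.1) z =1 cond p Z z \ox cond p Z z.
Proof.
have lz : law coupling (fun x => Z x.1) z = law p Z z.
  rewrite -[LHS]/(law coupling (Z \o fst) z) law_comp.
  by apply: eq_law => // i; rewrite law_coupling_fst.
move=> x; rewrite /cond /prodp lz /coupling.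
case: eqP => [->|_]; last by rewrite mul0r.
rewrite [z == _]eq_sym; case: eqP => _; last by rewrite mulr0 mul0r.
by rewrite -!mulrA; congr (_ * _); rewrite mulrCA.
Qed.

Lemma ent_coupling_chain (A : eqType) (F : I * I -> A) :
  ent coupling (fun x => (F x, Z x.1)) =
  ent p Z + \sum_z law p Z z * ent (cond p Z z \ox cond p Z z) F.
Proof.
rewrite ent_chain; last exact: pmf_coupling.
rewrite ent_coupling_fst; congr (_ + _); apply: eq_bigr => z _.
rewrite -[law coupling _ _]/(law coupling (Z \o fst) z) law_comp.
rewrite (eq_law law_coupling_fst (frefl _)); congr (_ * _).
by apply: eq_ent => // x; rewrite cond_coupling.
Qed.

Lemma ent_coupling_pair (A B : eqType) (f : I -> A) (g : I -> B) :
  ent coupling (fun x => (f x.1, g x.2, Z x.1)) =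
  ent p (fun i => (f i, Z i)) + ent p (fun i => (g i, Z i)) - ent p Z.
Proof.
rewrite (ent_coupling_chain (fun x => (f x.1, g x.2))) !ent_chain //.
rewrite [RHS](_ : _ = ent p Z + (\sum_z law p Z z * ent (cond p Z z) f +
  \sum_z law p Z z * ent (cond p Z z) g)); last by ring.
congr (_ + _); rewrite -big_split; apply: eq_bigr => z _ /=.
have [->|z0] := eqVneq (law p Z z) 0; first by rewrite !mul0r addr0.
by rewrite ent_prod ?mulrDr //; apply: pmf_cond.
Qed.

End Coupling.

Section Char2.
Variables (R : realType) (G : finZmodType).
Hypothesis addxx : forall x : G, x + x = 0.

Let addxK (x y : G) : x + (x + y) = y.
Proof. by rewrite addrA addxx add0r. Qed.

(** The right-hand side is [I(A:B|S) + I(A:A+B|S) + I(B:A+B|S)]. For copies (A1, B1), (A2, B2)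
    independent given [Z], the average is [H(A1+B2, Z) - H(A, B, S)]; the key is to bound
    [H(A1+B2, S)] by submodularity for A1 and B1 given (A1 + B2, S). *)
Lemma entropic_balog_szemeredi_gowers (I T : finType) (p : I -> R) (A B : I -> G) (S : I -> T)
    (Z := fun i => (A i + B i, S i)) :
  pmf p ->
  \sum_z law p Z z * rd (cond p Z z) A (cond p Z z) B <=
  2 * (ent p (fun i => (A i, S i)) + ent p (fun i => (B i, S i))) - 3 * ent p S
  - 3 * ent p (fun i => (A i, B i, S i)) + 2 * ent p Z.
Proof.
move=> pp; set w := coupling p Z; have pw : pmf w by exact: pmf_coupling.
have wZ x : w x != 0 -> Z x.1 = Z x.2.
  by rewrite /w /coupling; have [//|_] := eqVneq (Z x.1) (Z x.2); rewrite eqxx.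
set J := ent p (fun i => (A i, B i, S i)).
have JA : ent p (fun i => (A i, Z i)) = J.
  apply: ent_eq => // i j _ _; first by case=> -> /addrI -> ->.
  by rewrite /Z => -[-> -> ->].
have JB : ent p (fun i => (B i, Z i)) = J.
  apply: ent_eq => // i j _ _; last by rewrite /Z => -[-> -> ->].
  by case=> e1 + ->; rewrite e1 => /addIr->.
have -> : \sum_z law p Z z * rd (cond p Z z) A (cond p Z z) B =
    ent w (fun x => (A x.1 + B x.2, Z x.1)) - J.
  rewrite (ent_coupling_chain _ _ (fun x => A x.1 + B x.2)) //.
  move: JA JB; rewrite !ent_chain // => JA JB.
  pose a z := law p Z z * ent (cond p Z z) A.
  pose b z := law p Z z * ent (cond p Z z) B.
  rewrite (eq_bigr (fun z => law p Z z *
    ent (cond p Z z \ox cond p Z z) (fun x => A x.1 + B x.2) - (a z + b z) / 2)).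
    rewrite sumrB -mulr_suml big_split /=; move: JA JB; rewrite -/a -/b => *; lra.
  by move=> z _; rewrite /rd /a /b; ring.
have h1 : ent w (fun x => (A x.1 + B x.2, Z x.1)) <=
    ent w (fun x => (A x.1 + B x.2, S x.1)) + ent p Z - ent p S.
  have := ent_submod pw (fun x => A x.1 + B x.2) (fun x => Z x.1) (fun x => S x.1).
  rewrite !(ent_coupling_fst Z pp).
  rewrite (@ent_eq _ _ _ pw _ _ (fun x => (A x.1 + B x.2, Z x.1, S x.1))
     (fun x => (A x.1 + B x.2, Z x.1))); first last.
  - by move=> i j _ _; rewrite /Z => -[-> -> ->].
  - by move=> i j _ _; rewrite /Z => -[-> -> ->].
  rewrite -/w (ent_coupling_fst Z pp (fun i => (Z i, S i))).
  rewrite (@ent_eq _ _ _ pp _ _ (fun x => (Z x, S x)) Z); first last.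
  - by move=> i j _ _; rewrite /Z => -[-> ->].
  - by move=> i j _ _ /(congr1 fst).
  by move=> *; lra.
have h2 : ent w (fun x => (A x.1, B x.2, S x.1)) <=
    ent p (fun i => (A i, S i)) + ent p (fun i => (B i, S i)) - ent p S.
  have := ent_submod pw (fun x => A x.1) (fun x => B x.2) (fun x => S x.1).
  rewrite (@ent_eq _ _ _ pw _ _ (fun x => (B x.2, S x.1)) (fun x => (B x.2, S x.2))).
  - rewrite (ent_coupling_swap _ _ (fun x => (B x.1, S x.1))).
    rewrite (ent_coupling_fst Z pp (fun i => (B i, S i))).
    rewrite (ent_coupling_fst Z pp (fun i => (A i, S i))).
    by rewrite (ent_coupling_fst Z pp S) => *; lra.
  - by move=> i j /wZ[_ e1] /wZ[_ e2] [-> e3]; rewrite -e1 -e2 e3.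
  - by move=> i j /wZ[_ e1] /wZ[_ e2] [-> e3]; rewrite e1 e2 e3.
have h3 : ent w (fun x => (A x.1 + B x.2, A x.1, S x.1)) =
    ent w (fun x => (A x.1, B x.2, S x.1)).
  apply: ent_eq => // i j _ _; last by case=> -> -> ->.
  by case=> + e -> ; rewrite e => /addrI->.
have h4 : ent w (fun x => (A x.1 + B x.2, B x.1, S x.1)) =
    ent w (fun x => (A x.1, B x.2, S x.1)).
  rewrite -(ent_coupling_swap _ _ (fun x => (A x.1, B x.2, S x.1))) /=.
  (* Exponent 2 enters here: A1 + B1 = A2 + B2 becomes A1 + B2 = A2 + B1, so this case is the
     previous one with the copies exchanged. *)
  have key i : w i != 0 -> A i.1 + B i.2 = A i.2 + B i.1.
    move=> /wZ[e _]; rewrite -[A i.1](addxK (B i.1)) [B i.1 + A i.1]addrC e.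
    by rewrite addrC [B i.1 + _]addrC addrA [A i.2 + _]addrC addxK.
  apply: ent_eq => // i j wi wj; rewrite !key //; have /wZ[_ ei] := wi; have /wZ[_ ej] := wj.
    by case=> + e3 e4; rewrite -ei -ej e3 e4 => /addIr->.
  by case=> -> -> e3; rewrite ei ej e3.
(* The first copy and A1 + B2 give B2, and the common value of A + B then gives A2: both copies are
   determined. *)
have h5 : ent w (fun x => (A x.1, B x.1, (A x.1 + B x.2, S x.1))) = 2 * J - ent p Z.
  rewrite (@ent_eq _ _ _ pw _ _ _
    (fun x => ((A x.1, B x.1, S x.1), (A x.2, B x.2, S x.2), Z x.1))); first last.
  - by move=> i j _ _ [-> -> -> _ -> _ _].
  - move=> i j /wZ[ei1 ei2] /wZ[ej1 ej2] [e1 e2]; rewrite e1 => /addrI e3 e4.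
    have e5 : A i.2 = A j.2.
      by apply: (@addIr _ (B i.2)); rewrite -ei1 e1 e2 ej1 e3.
    by rewrite /Z e1 e2 e3 e4 e5 -ei2 -ej2 e4.
  rewrite (ent_coupling_pair Z pp (fun i => (A i, B i, S i)) (fun i => (A i, B i, S i))).
  rewrite (@ent_eq _ _ _ pp _ _ (fun i => (A i, B i, S i, Z i))
    (fun i => (A i, B i, S i))); first by rewrite /J; ring.
  - by move=> i j _ _ [-> -> ->].
  - by move=> i j _ _; rewrite /Z => -[-> -> ->].
have := ent_submod pw (fun x => A x.1) (fun x => B x.1) (fun x => (A x.1 + B x.2, S x.1)).
rewrite h5.
rewrite (@ent_eq _ _ _ pw _ _ (fun x => (A x.1, (A x.1 + B x.2, S x.1)))
  (fun x => (A x.1 + B x.2, A x.1, S x.1))); first last.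
- by move=> i j _ _ [-> -> ->].
- by move=> i j _ _ [-> -> ->].
rewrite (@ent_eq _ _ _ pw _ _ (fun x => (B x.1, (A x.1 + B x.2, S x.1)))
  (fun x => (A x.1 + B x.2, B x.1, S x.1))); first last.
- by move=> i j _ _ [-> -> ->].
- by move=> i j _ _ [-> -> ->].
rewrite h3 h4 => *; lra.
Qed.

End Char2.

(** * Local minimizers of the distance functional *)

Section Assoc.
Variables (R : realType) (G : zmodType) (I J K : finType).
Variables (p : I -> R) (q : J -> R) (r : K -> R).

Lemma ent_addA (f : I -> G) (g : J -> G) (h : K -> G) :
  ent (p \ox (q \ox r)) (fun x => f x.1 + (g x.2.1 + h x.2.2)) =
  ent (p \ox q \ox r) (fun x => f x.1.1 + g x.1.2 + h x.2).
Proof.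
pose u (x : I * (J * K)) := ((x.1, x.2.1), x.2.2).
rewrite -(@ent_bij _ _ _ _ (p \ox (q \ox r)) _ u); first last.
- by move=> x; rewrite /prodp mulrA.
- by exists (fun x => (x.1.1, (x.1.2, x.2))); [case=> i [] | case=> [[]]].
by apply: eq_ent => // x /=; rewrite addrA.
Qed.

End Assoc.

Section LocalMinimizer.
Variables (R : realType) (G : finZmodType).
Hypothesis addxx : forall x : G, x + x = 0.

Let oppx (x : G) : - x = x.
Proof. by rewrite -[LHS]add0r -(addxx x) addrK. Qed.

(** Distance depends only on laws, so minimality among laws on [G] can be tested on variables over
    any sample space. *)
Lemma rd_law_id (I J : finType) (p : I -> R) (f : I -> G) (q : J -> R) (g : J -> G) :
  rd p f q g = rd (law p f) id (law q g) id.
Proof.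
rewrite /rd -(@ent_prod_map _ _ _ _ _ _ p q _ _ f g (fun x => x.1 + x.2)) //.
by rewrite -!ent_comp.
Qed.

Lemma rd_id_law (J : finType) (p : G -> R) (q : J -> R) (g : J -> G) :
  rd p id q g = rd p id (law q g) id.
Proof. by rewrite rd_law_id; apply: eq_rd => //; apply: law_id. Qed.

Variables (mu nu : G -> R) (eta : R).
Hypotheses (pmu : pmf mu) (pnu : pmf nu).
Let k := rd mu id nu id.
(** The penalty is measured from [mu] and [nu] themselves instead of from the given pair; the
    triangle inequality will derive this from minimality of the original functional. *)
Hypothesis local_min : forall p q : G -> R, pmf p -> pmf q ->
  k <= rd p id q id + eta * (rd mu id p id + rd nu id q id).

Lemma local_min_rv (I J : finType) (p : I -> R) (f : I -> G) (q : J -> R) (g : J -> G) :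
  pmf p -> pmf q -> k <= rd p f q g + eta * (rd mu id p f + rd nu id q g).
Proof.
move=> pp pq; have := local_min (pmf_law f pp) (pmf_law g pq).
by rewrite (rd_law_id p) (rd_id_law mu p) (rd_id_law nu q).
Qed.

Hypothesis eta0 : 0 <= eta.

Lemma local_min_cond (I J S T : finType) (p : I -> R) (f : I -> G) (Z : I -> S)
    (q : J -> R) (g : J -> G) (W : J -> T) : pmf p -> pmf q ->
  k <= ent (p \ox q) (fun x => (f x.1 + g x.2, (Z x.1, W x.2))) - ent p Z - ent q W
  - (ent p (fun i => (f i, Z i)) - ent p Z + ent q (fun j => (g j, W j)) - ent q W) / 2
  + eta * (ent (mu \ox p) (fun x => x.1 + f x.2)
           - (ent mu id + ent p (fun i => (f i, Z i)) - ent p Z) / 2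
           + (ent (nu \ox q) (fun x => x.1 + g x.2)
           - (ent nu id + ent q (fun j => (g j, W j)) - ent q W) / 2)).
Proof.
move=> pp pq; have [lZ sZ] := pmf_law Z pp; have [lW sW] := pmf_law W pq.
rewrite -avg_rd //.
have le1 := avg_rd_r id f Z pmu pp; have le2 := avg_rd_r id g W pnu pq.
apply: le_trans (lerD (lexx _) (ler_wpM2l eta0 (lerD le1 le2))).
pose a z := law p Z z * rd mu id (cond p Z z) f.
pose b w := law q W w * rd nu id (cond q W w) g.
rewrite -/(a _) -/(b _).
have -> : \sum_z a z = \sum_z \sum_w law q W w * a z.
  by apply: eq_bigr => z _; rewrite -mulr_suml sW mul1r.
have -> : \sum_w b w = \sum_z \sum_w law p Z z * b w.
  by rewrite exchange_big /=; apply: eq_bigr => w _; rewrite -mulr_suml sZ mul1r.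
have -> : k = \sum_z \sum_w law p Z z * law q W w * k.
  by under eq_bigr do rewrite -mulr_suml -mulr_sumr sW mulr1; rewrite -mulr_suml sZ mul1r.
rewrite -big_split /= mulr_sumr -big_split; apply: ler_sum => z _ /=.
rewrite -big_split /= mulr_sumr -big_split; apply: ler_sum => w _ /=.
have [z0|z0] := eqVneq (law p Z z) 0; first by rewrite /a z0 !(mul0r, mulr0, addr0).
have [w0|w0] := eqVneq (law q W w) 0; first by rewrite /b w0 !(mul0r, mulr0, addr0).
have := local_min_rv f g (pmf_cond pp z0) (pmf_cond pq w0).
move/(ler_wpM2l (mulr_ge0 (lZ z) (lW w))) => le; apply: (le_trans le).
rewrite le_eqVlt; apply/orP; left; apply/eqP; rewrite /a /b; ring.
Qed.

(** Both variables are conditioned on the same value [z] and then made independent, which is the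
    configuration bounded by the Balog-Szemeredi-Gowers inequality. *)
Lemma local_min_diag (I S : finType) (p : I -> R) (f g : I -> G) (Z : I -> S) :
  pmf p ->
  k <= \sum_z law p Z z * rd (cond p Z z) f (cond p Z z) g
  + eta * (ent (mu \ox p) (fun x => x.1 + f x.2)
           - (ent mu id + ent p (fun i => (f i, Z i)) - ent p Z) / 2
           + (ent (nu \ox p) (fun x => x.1 + g x.2)
           - (ent nu id + ent p (fun i => (g i, Z i)) - ent p Z) / 2)).
Proof.
move=> pp; have [lZ sZ] := pmf_law Z pp.
have le1 := avg_rd_r id f Z pmu pp; have le2 := avg_rd_r id g Z pnu pp.
apply: le_trans (lerD (lexx _) (ler_wpM2l eta0 (lerD le1 le2))).
have -> : k = \sum_z law p Z z * k by rewrite -mulr_suml sZ mul1r.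
rewrite -big_split /= mulr_sumr -big_split; apply: ler_sum => z _ /=.
have [z0|z0] := eqVneq (law p Z z) 0; first by rewrite z0 !(mul0r, mulr0, addr0).
have := local_min_rv f g (pmf_cond pp z0) (pmf_cond pp z0).
move/(ler_wpM2l (lZ z)) => le; apply: (le_trans le).
rewrite le_eqVlt; apply/orP; left; apply/eqP; ring.
Qed.

Lemma local_min_triv (I J : finType) (p : I -> R) (f : I -> G) (q : J -> R) (g : J -> G) :
  pmf p -> pmf q ->
  k <= ent (p \ox q) (fun x => f x.1 + g x.2) - (ent p f + ent q g) / 2
  + eta * (ent (mu \ox p) (fun x => x.1 + f x.2) - (ent mu id + ent p f) / 2
           + (ent (nu \ox q) (fun x => x.1 + g x.2) - (ent nu id + ent q g) / 2)).
Proof. exact: local_min_rv. Qed.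

(* With a, c distributed as mu and b, e as nu, all independent: *)
Let w := (mu \ox mu) \ox (nu \ox nu).
Let pw : pmf w. Proof. by do !apply: pmf_prod. Qed.
Let U (x : (G * G) * (G * G)) := x.1.1 + x.2.1.
Let V (x : (G * G) * (G * G)) := x.1.2 + x.2.1.
Let S (x : (G * G) * (G * G)) := (x.1.1 + x.1.2) + (x.2.1 + x.2.2).
Let J := ent w (fun x => (U x, V x, S x)).
Let HS := ent w S.
Let s := ent (mu \ox nu) (fun x => x.1 + x.2).
Let m1 := ent (mu \ox mu) (fun x => x.1 + x.2).
Let m2 := ent (nu \ox nu) (fun x => x.1 + x.2).
Let h1 := ent mu id.
Let h2 := ent nu id.

Let s' : ent (nu \ox mu) (fun x => x.1 + x.2) = s.
Proof. exact: (@ent_addC _ _ _ _ nu id mu id). Qed.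

Let triangle (p q r : G -> R) : pmf p -> pmf q -> pmf r ->
  ent (p \ox r) (fun x => x.1 + x.2) + ent q id <=
  ent (p \ox q) (fun x => x.1 + x.2) + ent (q \ox r) (fun x => x.1 + x.2).
Proof.
move=> pp pq pr; have := ent_sub_triangle id id id pp pq pr.
rewrite (@eq_ent _ _ _ _ (p \ox r) (fun x => x.1 - x.2) (fun x => x.1 + x.2)) // => x.
by rewrite oppx.
Qed.

Let add3 (p q r : G -> R) : pmf p -> pmf q -> pmf r ->
  ent (p \ox (q \ox r)) (fun x => x.1 + (x.2.1 + x.2.2)) + ent q id <=
  ent (p \ox q) (fun x => x.1 + x.2) + ent (q \ox r) (fun x => x.1 + x.2).
Proof.
move=> pp pq pr; have := kaimanovich_vershik id id id pp pq pr.
by rewrite -(ent_addA p q r id id id).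
Qed.

Let m1_le : m1 + h2 <= 2 * s.
Proof. have := triangle pmu pnu pmu; rewrite s' -/s -/m1 -/h2 => *; lra. Qed.

Let m2_le : m2 + h1 <= 2 * s.
Proof. have := triangle pnu pmu pnu; rewrite s' -/s -/m2 -/h1 => *; lra. Qed.

Let w1 := (nu \ox mu) \ox (mu \ox nu).
Let u1 (x : (G * G) * (G * G)) := ((x.1.2, x.2.1), (x.2.2, x.1.1)).

Let ent_w1 (T : eqType) (F : (G * G) * (G * G) -> T) : ent w1 (F \o u1) = ent w F.
Proof.
apply: ent_bij; last by case=> [[e a] [c b]]; rewrite /w /w1 /prodp /=; ring.
exists (fun x => ((x.2.2, x.1.1), (x.1.2, x.2.1))); first by case=> [[e a] [c b]].
by case=> [[a c] [b e]].
Qed.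

Let S_perm (e a c b : G) : e + a + (c + b) = (a + c) + (b + e).
Proof. by rewrite [e + a]addrC addrACA [e + b]addrC. Qed.

Let S_u1 x : S (u1 x) = x.1.1 + x.1.2 + (x.2.1 + x.2.2).
Proof. by rewrite [RHS]S_perm. Qed.

Let V_sum (a b c : G) : (a + b) + (a + c) = c + b.
Proof. by rewrite addrACA addxx add0r addrC. Qed.

Let W_sum (a b c : G) : (a + b) + (c + b) = a + c.
Proof. by rewrite addrACA addxx addr0. Qed.

Let kE : k = s - (h1 + h2) / 2. Proof. by []. Qed.

Let k0 : 0 <= k. Proof. exact: rd_ge0. Qed.

(** In each of the five comparisons the factor of [eta] is at most [8 k]. *)
Let slack x : x <= 8 * k -> eta * x <= 8 * (eta * k).
Proof. by move=> /(ler_wpM2l eta0); rewrite mulrCA. Qed.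

(* Minimality is tested against a + e, b + c and their fibres ([mixed], [mixed_fibre])
   and against a + c, b + e and their fibres ([same], [same_fibre]).  Added in pairs,
   these bound I(U : V | S) and I(U : a + c | S) by 16 eta k. *)
Let mixed : k <= HS - s + 8 * (eta * k).
Proof.
have := @local_min_triv _ _ (nu \ox mu) (fun x => x.1 + x.2)
  (mu \ox nu) (fun x => x.1 + x.2) (pmf_prod pnu pmu) (pmf_prod pmu pnu).
rewrite -/w1 -/s s' -/h1 -/h2.
have -> : ent w1 (fun x => x.1.1 + x.1.2 + (x.2.1 + x.2.2)) = HS.
  by rewrite /HS -ent_w1; apply: eq_ent => // x; rewrite [RHS]S_u1.
have := add3 pmu pnu pmu; have := add3 pnu pmu pnu; rewrite s' -/s -/h1 -/h2 => a1 a2.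
move=> le; apply: (le_trans le); apply: lerD; first lra.
by apply: slack; move: k0 m1_le m2_le; rewrite kE => *; lra.
Qed.

Let mixed_fibre : k <= J - (h1 + h2) - s + 8 * (eta * k).
Proof.
have := @local_min_cond _ _ _ _ (nu \ox mu) snd (fun x => x.1 + x.2)
  (mu \ox nu) snd (fun x => x.1 + x.2) (pmf_prod pnu pmu) (pmf_prod pmu pnu).
rewrite -/w1 -/s s' -/h1 -/h2.
have pw1 : pmf w1 by rewrite /w1; do !apply: pmf_prod.
have -> : ent w1 (fun x => (x.1.2 + x.2.2, (x.1.1 + x.1.2, x.2.1 + x.2.2))) = J.
  rewrite /J -ent_w1; apply: ent_eq => // i j _ _; rewrite /comp !S_u1 /U /V /u1 /=.
    by case=> -> -> ->.
  by case=> -> -> /addIr ->.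
have joint (p q : G -> R) : pmf p -> pmf q ->
    ent (p \ox q) (fun x => (x.2, x.1 + x.2)) = ent p id + ent q id.
  move=> pp pq; rewrite -(@ent_prod _ _ _ _ _ p q id id) //.
  apply: ent_eq; first exact: pmf_prod.
    by move=> i j _ _ [-> /addIr->].
  by move=> i j _ _ [-> ->].
rewrite !joint // -/h1 -/h2.
have snd_id (p q r : G -> R) : pmf q ->
    ent (p \ox (q \ox r)) (fun x => x.1 + x.2.2) = ent (p \ox r) (fun x => x.1 + x.2).
  move=> pq; apply: (@ent_prod_map _ _ _ _ _ _ _ _ _ _ id snd (fun x => x.1 + x.2)).
    exact: law_id.
  exact: law_snd.
rewrite !snd_id // -/m1 -/m2 => le; apply: (le_trans le); apply: lerD; first lra.
by apply: slack; move: k0 m1_le m2_le; rewrite kE => *; lra.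
Qed.

Let same : k <= HS - (m1 + m2) / 2 + 8 * (eta * k).
Proof.
have := @local_min_triv _ _ (mu \ox mu) (fun x => x.1 + x.2)
  (nu \ox nu) (fun x => x.1 + x.2) (pmf_prod pmu pmu) (pmf_prod pnu pnu).
rewrite -/w -[ent w _]/HS -/h1 -/h2 -/m1 -/m2.
have := add3 pmu pmu pmu; have := add3 pnu pnu pnu; rewrite -/m1 -/m2 -/h1 -/h2 => a1 a2.
move=> le; apply: (le_trans le); apply: lerD; first lra.
by apply: slack; move: k0 m1_le m2_le; rewrite kE => *; lra.
Qed.

Let same_fibre : k <= J - (m1 + m2) / 2 - (h1 + h2) + 8 * (eta * k).
Proof.
have := @local_min_cond _ _ _ _ (mu \ox mu) fst (fun x => x.1 + x.2)
  (nu \ox nu) fst (fun x => x.1 + x.2) (pmf_prod pmu pmu) (pmf_prod pnu pnu).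
rewrite -/w -/m1 -/m2 -/h1 -/h2.
have -> : ent w (fun x => (x.1.1 + x.2.1, (x.1.1 + x.1.2, x.2.1 + x.2.2))) = J.
  rewrite /J; apply: ent_eq => // i j _ _; rewrite /S /U /V.
    by case=> e1 e2 ->; rewrite -(V_sum i.1.1 i.2.1 i.1.2) e1 e2 V_sum.
  case=> e1 e2; have e3 : i.1.1 + i.1.2 = j.1.1 + j.1.2.
    by rewrite -(W_sum i.1.1 i.2.1) e1 e2 W_sum.
  by rewrite e1 e3 => /addrI ->.
have joint (p q : G -> R) : pmf p -> pmf q ->
    ent (p \ox q) (fun x => (x.1, x.1 + x.2)) = ent p id + ent q id.
  move=> pp pq; rewrite -(@ent_prod _ _ _ _ _ p q id id) //.
  apply: ent_eq; first exact: pmf_prod.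
    by move=> i j _ _ [-> /addrI->].
  by move=> i j _ _ [-> ->].
rewrite !joint // -/h1 -/h2.
have fst_id (p q r : G -> R) : pmf r ->
    ent (p \ox (q \ox r)) (fun x => x.1 + x.2.1) = ent (p \ox q) (fun x => x.1 + x.2).
  move=> pq; apply: (@ent_prod_map _ _ _ _ _ _ _ _ _ _ id fst (fun x => x.1 + x.2)).
    exact: law_id.
  exact: law_fst.
rewrite !fst_id // -/m1 -/m2 => le; apply: (le_trans le); apply: lerD; first lra.
by apply: slack; move: k0 m1_le m2_le; rewrite kE => *; lra.
Qed.

Let ent_US : ent w (fun x => (U x, S x)) = 2 * s.
Proof.
pose t (x : (G * G) * (G * G)) := ((x.1.1, x.2.1), (x.1.2, x.2.2)).
transitivity (ent w (fun x => (x.1.1 + x.2.1, x.1.2 + x.2.2))).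
  apply: ent_eq => // i j _ _; rewrite /U /S.
    by case=> e1; rewrite addrACA [X in _ = X -> _]addrACA e1 => /addrI ->.
  by case=> e1 e2; rewrite addrACA e1 e2 addrACA.
rewrite -[LHS]/(ent w ((fun x => (x.1.1 + x.1.2, x.2.1 + x.2.2)) \o t)).
rewrite (@ent_bij _ _ _ _ _ ((mu \ox nu) \ox (mu \ox nu))); first last.
- by case=> [[a c] [b e]]; rewrite /w /prodp /=; ring.
- by exists t; case=> [[a c] [b e]].
rewrite (@ent_prod _ _ _ _ _ (mu \ox nu) (mu \ox nu) (fun x => x.1 + x.2)
  (fun x => x.1 + x.2)) //; try exact: pmf_prod.
rewrite -/s; ring.
Qed.

Let ent_VS : ent w (fun x => (V x, S x)) = 2 * s.
Proof.
pose t (x : (G * G) * (G * G)) := ((x.1.2, x.1.1), x.2).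
rewrite -ent_US -(@ent_bij _ _ _ _ w w t (fun x => (U x, S x))); first last.
- by case=> [[a c] [b e]]; rewrite /w /prodp /= [mu a * _]mulrC.
- by exists t; case=> [[a c] [b e]].
by apply: eq_ent => // x; rewrite /U /V /S /= [x.1.1 + x.1.2]addrC.
Qed.

Let ent_Z : ent w (fun x => (U x + V x, S x)) = m1 + m2.
Proof.
rewrite -(@ent_prod _ _ _ _ _ (mu \ox mu) (nu \ox nu) (fun x => x.1 + x.2)
  (fun x => x.1 + x.2)) //; try exact: pmf_prod.
apply: ent_eq => // i j _ _; rewrite /U /V /S !W_sum.
  by case=> -> /addrI->.
by case=> -> ->.
Qed.

Let ent_w : ent w id = 2 * h1 + 2 * h2.
Proof.
transitivity (ent w (fun x => ((x.1.1, x.1.2), (x.2.1, x.2.2)))).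
  by apply: eq_ent => // -[[a c] [b e]].
rewrite (@ent_prod _ _ _ _ _ (mu \ox mu) (nu \ox nu) (fun x => (x.1, x.2))
  (fun x => (x.1, x.2))) //; try exact: pmf_prod.
rewrite (@ent_prod _ _ _ _ _ mu mu id id) // (@ent_prod _ _ _ _ _ nu nu id id) //.
by rewrite -/h1 -/h2; ring.
Qed.

Let ent_w_a : ent w (fun x => x.1.1) = h1.
Proof.
rewrite (@ent_fst _ _ _ _ (mu \ox mu) (nu \ox nu) fst); last exact: pmf_prod.
exact: (@ent_fst _ _ _ _ mu mu id).
Qed.

Let ent_w_b : ent w (fun x => x.2.1) = h2.
Proof.
rewrite (@ent_snd _ _ _ _ (mu \ox mu) (nu \ox nu) fst); last exact: pmf_prod.
exact: (@ent_fst _ _ _ _ nu nu id).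
Qed.

(** Adding [a] (below: [b]) to the triple determines all four variables, whose joint entropy is
    [2 h1 + 2 h2]. *)
Let J_ge1 : h1 + 2 * h2 <= J.
Proof.
have := ent_pair_le pw (fun x => (U x, V x, S x)) (fun x => x.1.1).
rewrite (@ent_eq _ _ _ pw _ _ _ id) ?ent_w ?ent_w_a -/J; first by move=> *; lra.
- move=> [[a c] [b e]] [[a' c'] [b' e']] _ _; rewrite /U /V /S /= => -[+ + + ea].
  by rewrite ea => /addrI -> /addIr -> /addrI/addrI->.
- by move=> i j _ _ ->.
Qed.

Let J_ge2 : 2 * h1 + h2 <= J.
Proof.
have := ent_pair_le pw (fun x => (U x, V x, S x)) (fun x => x.2.1).
rewrite (@ent_eq _ _ _ pw _ _ _ id) ?ent_w ?ent_w_b -/J; first by move=> *; lra.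
- move=> [[a c] [b e]] [[a' c'] [b' e']] _ _; rewrite /U /V /S /= => -[+ + + eb].
  by rewrite eb => /addIr -> /addIr -> /addrI/addrI->.
- by move=> i j _ _ ->.
Qed.

Let law_w_ba : law w (fun x => (x.2.1, x.1.1)) =1 nu \ox mu.
Proof.
move=> [b a]; rewrite /prodp mulrC -(law_fst mu pmu a) -(law_fst nu pnu b) -law_prod.
by apply: eq_bigl => x; rewrite !xpair_eqE andbC.
Qed.

Let law_w_cb : law w (fun x => (x.1.2, x.2.1)) =1 mu \ox nu.
Proof.
move=> [c b]; rewrite /prodp -(law_snd mu pmu c) -(law_fst nu pnu b) -law_prod.
by apply: eq_bigl => x; rewrite !xpair_eqE.
Qed.

Let mu_U : ent (mu \ox w) (fun x => x.1 + U x.2) + h2 <= 2 * s.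
Proof.
have := add3 pmu pnu pmu; rewrite s' -/s -/h2 => le.
rewrite (_ : ent _ _ = ent (mu \ox (nu \ox mu)) (fun x => x.1 + (x.2.1 + x.2.2))).
  lra.
rewrite -(@ent_prod_map _ _ _ _ _ _ _ _ _ _ id _ _ (law_id mu) law_w_ba).
by apply: eq_ent => // x; rewrite /U [x.2.1.1 + _]addrC.
Qed.

Let nu_V : ent (nu \ox w) (fun x => x.1 + V x.2) + h1 <= 2 * s.
Proof.
have := add3 pnu pmu pnu; rewrite s' -/s -/h1 => le.
rewrite (_ : ent _ _ = ent (nu \ox (mu \ox nu)) (fun x => x.1 + (x.2.1 + x.2.2))).
  lra.
by rewrite -(@ent_prod_map _ _ _ _ _ _ _ _ _ _ id _ _ (law_id nu) law_w_cb).
Qed.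

Hypothesis eta_le : eta <= 1 / 100.

(** Since [H(U,S) = H(V,S)], the Balog-Szemeredi-Gowers bound is [I(U:V|S) + 2 I(U:U+V|S)], at most
    [48 eta k]. Testing minimality on the fibres of (U + V, S) costs another [8 eta k], so
    [k <= 56 eta k]. *)
Lemma local_min_rd0 : k = 0.
Proof.
have := local_min_diag U V (fun x => (U x + V x, S x)) pw.
have := entropic_balog_szemeredi_gowers addxx U V S pw.
move=> /= bsg le; have {bsg}le := le_trans le (lerD bsg (lexx _)).
move: le.
have -> : ent w (fun i => (U i, (U i + V i, S i))) = J.
  apply: ent_eq => // i j _ _; last by case=> -> -> ->.
  by case=> -> /addrI -> ->.
have -> : ent w (fun i => (V i, (U i + V i, S i))) = J.
  apply: ent_eq => // i j _ _; last by case=> -> -> ->.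
  by case=> e2 + ->; rewrite e2 => /addIr ->.
rewrite ent_US ent_VS ent_Z -/J -[ent w S]/HS -/h1 -/h2 => le.
have ek : 100 * (eta * k) <= k.
  by rewrite mulrA ler_piMl ?k0 //; move: eta_le => ?; lra.
have {}le : k <= 8 * s - 3 * HS - 3 * J + 2 * (m1 + m2) + 8 * (eta * k).
  apply: (le_trans le); apply: lerD; first lra.
  apply: slack; move: k0; rewrite kE.
  by move: J_ge1 J_ge2 mu_U nu_V m1_le m2_le => *; lra.
by move: k0 mixed mixed_fibre same same_fibre kE => *; lra.
Qed.

End LocalMinimizer.

(** * Existence of minimizers *)

Section Minimizer.
Import boolp classical_sets topology normedtype derive realfun.
Import numFieldNormedType.Exports.
Local Open Scope classical_set_scope.
Variable R : realType.

(** As [ln] vanishes on nonpositive reals, so does the function. For [0 < y < 1] it lies between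
    [- 2 sqrt y] and 0, by [ln u <= u - 1] at [u = 1 / sqrt y]. *)
Lemma xlnx_continuous : continuous (fun x : R => x * ln x).
Proof.
move=> x; have [x0|x0] := ltP 0 x.
  by apply: cvgM; [exact: cvg_id | exact: continuous_ln].
have e : x * ln x = 0 by rewrite ln0 ?mulr0.
have s0 : Num.sqrt x = 0 by apply: ler0_sqrtr.
rewrite /continuous_at e; apply: (@squeeze_cvgr _ _ _ _ (fun y => - (2 * Num.sqrt y)) (fun=> 0)).
- near=> y; have y1 : y < 1.
    by near: y; apply: lt_nbhsl; apply: le_lt_trans x0 _; exact: ltr01.
  have [y0|y0] := leP y 0; first by rewrite ln0 // ler0_sqrtr // !mulr0 oppr0 lexx.
  have t0 : 0 < Num.sqrt y by rewrite sqrtr_gt0.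
  have ty : Num.sqrt y ^+ 2 = y by rewrite sqr_sqrtr // ltW.
  have ly : ln y <= 0 by rewrite ln_le0 // ltW.
  rewrite mulr_ge0_le0 ?(ltW y0) // andbT -{2 3}ty lnXn //.
  have := ln_le_subr1 (_ : 0 < (Num.sqrt y)^-1); rewrite invr_gt0 => /(_ t0).
  rewrite lnV ?posrE // => /(ler_wpM2l (ltW (exprn_gt0 2 t0))).
  rewrite mulrBr mulr1 expr2 mulfK ?gt_eqF // mulrN.
  by have := sqr_ge0 (Num.sqrt y); rewrite expr2 mulr2n => *; lra.
- have : - (2 * Num.sqrt y) @[y --> x] --> - (2 * Num.sqrt x).
    by apply: cvgN; apply: cvgM; [exact: cvg_cst | exact: sqrt_continuous].
  by rewrite s0 mulr0 oppr0.
- exact: cvg_cst.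
Unshelve. all: by end_near. Qed.

Lemma continuous_sum_fin (V : topologicalType) (I : finType) (P : pred I)
    (F : I -> V -> R) :
  (forall i, continuous (F i)) -> continuous (fun v => \sum_(i | P i) F i v).
Proof.
by move=> cF; apply: continuous_big => [|i _]; [exact: add_continuous | exact: cF].
Qed.

Lemma continuous_ent (V : topologicalType) (I T : finType) (p : V -> I -> R)
    (f : I -> T) :
  (forall i, continuous (fun v => p v i)) -> continuous (fun v => ent (p v) f).
Proof.
move=> cp; under eq_fun do rewrite entE.
move=> v; apply: cvgN; apply: continuous_sum_fin => t {}v.
apply: (@continuous_comp _ _ _ (fun v => law (p v) f t) (fun x => x * ln x)).
  exact: continuous_sum_fin.
exact: xlnx_continuous.
Qed.

Lemma continuous_rd (V : topologicalType) (I J : finType) (G : finZmodType)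
    (p : V -> I -> R) (f : I -> G) (q : V -> J -> R) (g : J -> G) :
  (forall i, continuous (fun v => p v i)) -> (forall j, continuous (fun v => q v j)) ->
  continuous (fun v => rd (p v) f (q v) g).
Proof.
move=> cp cq v; apply: cvgB.
  apply: (@continuous_ent _ _ _ (fun v => p v \ox q v)) => x {}v.
  by apply: cvgM; [exact: cp | exact: cq].
apply: cvgM; last exact: cvg_cst.
by apply: cvgD; apply: continuous_ent.
Qed.

(** A pair of laws is encoded as one point of a closed subset of a cube, which is compact. Asking
    for continuity of [F] along all continuous families of functions spares a topology on
    [I -> R]. *)
Lemma exists_minimizer (I J : finType) (p0 : I -> R) (q0 : J -> R)
    (F : (I -> R) -> (J -> R) -> R) :
  pmf p0 -> pmf q0 ->
  (forall (V : topologicalType) (p : V -> I -> R) (q : V -> J -> R),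
    (forall i, continuous (fun v => p v i)) -> (forall j, continuous (fun v => q v j)) ->
    continuous (fun v => F (p v) (q v))) ->
  exists p q, [/\ pmf p, pmf q &
    forall p' q', pmf p' -> pmf q' -> F p q <= F p' q'].
Proof.
move=> pp0 pq0 cF; pose n := #|{: I + J}|.
pose fp (v : 'rV[R]_n) (i : I) := v ord0 (enum_rank (inl i : I + J)%type).
pose fq (v : 'rV[R]_n) (j : J) := v ord0 (enum_rank (inr j : I + J)%type).
have cp i : continuous (fun v => fp v i) by exact: coord_continuous.
have cq j : continuous (fun v => fq v j) by exact: coord_continuous.
pose vec (p : I -> R) (q : J -> R) : 'rV[R]_n :=
  \row_k match enum_val k with inl i => p i | inr j => q j end.
have fpE p q : fp (vec p q) = p by apply: funext => i; rewrite /fp mxE enum_rankK.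
have fqE p q : fq (vec p q) = q by apply: funext => j; rewrite /fq mxE enum_rankK.
pose C := [set v : 'rV[R]_n | forall k, `[0, 1]%classic (v ord0 k)].
pose B := [set v | \sum_i fp v i = 1] `&` [set v | \sum_j fq v j = 1].
have cC : compact C.
  by apply: (@rV_compact _ _ (fun=> `[0 : R, 1]%classic)) => _; exact: segment_compact.
have cB : closed B.
  apply: closedI.
    apply: (@preimage_closed _ _ (fun v => \sum_i fp v i) [set 1]).
      by move=> v _; apply: continuous_sum_fin.
    exact: closed_eq.
  apply: (@preimage_closed _ _ (fun v => \sum_j fq v j) [set 1]).
    by move=> v _; apply: continuous_sum_fin.
  exact: closed_eq.
have inA p q : pmf p -> pmf q -> (C `&` B) (vec p q).
  move=> [pp0' pp1] [pq0' pq1]; split; last by split; rewrite /= ?fpE ?fqE.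
  move=> k; rewrite mxE /= in_itv /=; case: (enum_val k) => [i|j].
    by rewrite pp0' -pp1 (bigD1 i) //= lerDl sumr_ge0.
  by rewrite pq0' -pq1 (bigD1 j) //= lerDl sumr_ge0.
have cA : compact (C `&` B).
  by rewrite setIC; apply: (subclosed_compact _ cC); [exact: closedI (compact_closed _ _) | ].
have A0 : C `&` B !=set0 by exists (vec p0 q0); exact: inA.
have cf : {within C `&` B, continuous (fun v => F (fp v) (fq v))}.
  by apply: continuous_subspaceT; exact: cF.
have [v /set_mem[vC [v1 v2]] vmin] := compact_EVT_min A0 cA cf.
exists (fp v), (fq v); split.
- by split=> // i; have := vC (enum_rank (inl i : I + J)%type); rewrite /= in_itv /= => /andP[].
- by split=> // j; have := vC (enum_rank (inr j : I + J)%type); rewrite /= in_itv /= => /andP[].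
move=> p' q' pp' pq'; have := vmin (vec p' q') (mem_set (inA _ _ pp' pq')).
by rewrite fpE fqE.
Qed.

Lemma exists_rd_minimizer (G : finZmodType) (eta : R) (x0 y0 : G -> R) :
  pmf x0 -> pmf y0 -> exists mu nu, [/\ pmf mu, pmf nu &
    forall p q, pmf p -> pmf q ->
    rd mu id nu id + eta * (rd x0 id mu id + rd y0 id nu id) <=
    rd p id q id + eta * (rd x0 id p id + rd y0 id q id)].
Proof.
move=> px py; apply: (@exists_minimizer _ _ x0 y0
  (fun p q => rd p id q id + eta * (rd x0 id p id + rd y0 id q id))) => // V p q cp cq v.
apply: cvgD; first exact: continuous_rd.
apply: cvgM; first exact: cvg_cst.
by apply: cvgD; apply: continuous_rd => // i {}v; exact: cvg_cst.
Qed.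

End Minimizer.

(** * Entropic polynomial Freiman-Ruzsa in exponent 2 *)

Section GibbsApplications.
Variable R : realType.

Lemma ent_le_ln_card (I T : finType) (p : I -> R) (f : I -> T) (S : {set T}) :
  pmf p -> (forall i, p i != 0 -> f i \in S) -> ent p f <= ln #|S|%:R.
Proof.
move=> pp fS; have [l0 l1] := pmf_law f pp.
have lS t : law p f t != 0 -> t \in S.
  rewrite /law psumr_neq0 => [/hasP[i _ /andP[/eqP <- /lt0r_neq0/fS//]]|i _].
  exact: pp.1.
have S0 : (0 < #|S|%:R :> R).
  rewrite ltr0n lt0n; apply/eqP => /cards0_eq S0.
  have : \sum_t law p f t = 0.
    by apply: big1 => t _; apply/eqP; apply: contraT => /lS; rewrite S0 inE.
  by rewrite l1 => /eqP; rewrite oner_eq0.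
pose q t : R := if t \in S then #|S|%:R^-1 else 0.
have q0 t : 0 <= q t by rewrite /q; case: ifP => // _; rewrite invr_ge0 ltW.
have q1 : \sum_t q t <= 1.
  by rewrite /q -big_mkcond /= sumr_const -[X in X <= _]mulr_natl mulfV ?gt_eqF.
have pq t : 0 < law p f t -> 0 < q t.
  by move=> /lt0r_neq0/lS tS; rewrite /q tS invr_gt0.
have := gibbs (pmf_law f pp) q0 q1 pq.
rewrite entE (eq_bigr (fun t => law p f t * - ln #|S|%:R)).
  by rewrite -mulr_suml l1 => *; lra.
move=> t _; have [->|/lS tS] := eqVneq (law p f t) 0; first by rewrite !mul0r.
by rewrite /q tS lnV.
Qed.

(** The equality case of Gibbs' inequality against the product of the marginals. *)
Lemma law_pair_indep (I A B : finType) (p : I -> R) (f : I -> A) (g : I -> B) :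
  pmf p -> ent p (fun i => (f i, g i)) = ent p f + ent p g ->
  forall a b, law p (fun i => (f i, g i)) (a, b) = law p f a * law p g b.
Proof.
move=> pp e a b; pose fg i := (f i, g i).
pose q (t : A * B) := law p f t.1 * law p g t.2.
have [lf0 lf1] := pmf_law f pp; have [lg0 lg1] := pmf_law g pp.
have q0 t : 0 <= q t by exact: mulr_ge0.
have q1 : \sum_t q t <= 1.
  rewrite /q -(pair_bigA _ (fun a b => law p f a * law p g b)) /=.
  by under eq_bigr do rewrite -mulr_sumr lg1 mulr1; rewrite lf1.
have pq t : 0 < law p fg t -> 0 < q t.
  move=> /lt0r_neq0; rewrite /law psumr_neq0 => [|i _]; last exact: pp.1.
  by case/hasP=> i _ /andP[/eqP <- pi]; rewrite /q mulr_gt0 ?law_gt0.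
rewrite -(gibbs_eq (pmf_law fg pp) q0 q1 pq) //.
have := e; rewrite [X in X = _]entE /ent -/fg => e'.
rewrite -(sum_law p fg (fun t => ln (q t))).
apply: oppr_inj; rewrite e' -opprD -big_split /=; congr (- _).
apply: eq_bigr => i _; rewrite -mulrDr.
have [->|/(pmf_gt0 pp) pi] := eqVneq (p i) 0; first by rewrite !mul0r.
by rewrite /q lnM ?posrE ?law_gt0.
Qed.

End GibbsApplications.

Section Char2.
Variables (R : realType) (G : finZmodType).
Hypothesis addxx : forall x : G, x + x = 0.

Let oppx (x : G) : - x = x.
Proof. by rewrite -[LHS]add0r -(addxx x) addrK. Qed.

Lemma rd_triangle (p q r : G -> R) : pmf p -> pmf q -> pmf r ->
  rd p id r id <= rd p id q id + rd q id r id.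
Proof.
move=> pp pq pr; have := ent_sub_triangle id id id pp pq pr.
rewrite (@eq_ent _ _ _ _ (p \ox r) (fun x => x.1 - x.2) (fun x => x.1 + x.2)) //.
  by rewrite /rd => *; lra.
by move=> x; rewrite oppx.
Qed.

(** Distance 0 makes the sum of two copies independent of the second copy. Hence [mu (s + u)] is the
    same for every [u] in the support, and the support translated by one of its points is a
    subgroup. *)
Lemma rd_self0_coset (mu : G -> R) : pmf mu -> rd mu id mu id = 0 ->
  exists (H : {set G}) (t : G), [/\ 0 \in H, {in H &, forall x y, x + y \in H} &
    forall x, mu x = if x + t \in H then #|H|%:R^-1 else 0].
Proof.
move=> pmu d0; have pw := pmf_prod pmu pmu.
pose f (x : G * G) := x.1 + x.2.
have ind := @law_pair_indep _ _ _ _ (mu \ox mu) f snd pw.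
have {}ind s t : mu (s + t) * mu t = law (mu \ox mu) f s * mu t.
  rewrite -(law_snd mu pmu t) -ind.
    rewrite (law_snd mu pmu t) /law (big_pred1 (s + t, t)) //= => -[x y] /=.
    by rewrite /f !xpair_eqE /=; case: (y =P t) => [->|]; rewrite ?andbF ?andbT //;
       apply/eqP/eqP => [<-|->]; rewrite -addrA addxx addr0.
  rewrite (ent_snd mu id pmu); move: d0; rewrite /rd -/f => d0.
  rewrite (@ent_eq _ _ _ pw _ _ _ (fun x => (x.1, x.2))); first last.
  - by move=> i j _ _; rewrite /f => -[-> ->].
  - by move=> i j _ _; rewrite /f => -[+ e]; rewrite e => /addIr->.
  by rewrite (ent_prod id id pmu pmu); move: d0; rewrite -/(f _) => *; lra.
have [t t0] : exists t, mu t != 0.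
  apply/existsP; apply: contra_eqT pmu.2 => /existsPn n0; rewrite big1.
    by rewrite eq_sym oner_eq0.
  by move=> i _; apply/eqP; have := n0 i; rewrite negbK.
have inv s u : mu u != 0 -> mu (s + u) = law (mu \ox mu) f s.
  by move=> u0; apply: (mulIf u0); exact: ind.
pose H := [set h | mu (t + h) != 0].
have shift h x : h \in H -> mu (x + h) = mu x.
  rewrite inE => th; have e u : mu u != 0 -> mu x = law (mu \ox mu) f (x + u).
    by move=> u0; rewrite -(inv _ u) // -addrA addxx addr0.
  by rewrite (e (t + h)) // [t + h]addrC addrA -(inv _ t) // -[_ + t + t]addrA addxx addr0.
have muE x : mu x = if x + t \in H then mu t else 0.
  rewrite inE [t + _]addrC -addrA addxx addr0.
  case: eqP => //= /eqP x0; rewrite -(shift (x + t) t); last first.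
    by rewrite inE [t + _]addrC -addrA addxx addr0.
  by rewrite [t + _]addrC -addrA addxx addr0.
have sumH : \sum_x mu x = #|H|%:R * mu t.
  rewrite (eq_bigr _ (fun x _ => muE x)) -big_mkcond /= sumr_const mulr_natl.
  congr (_ *+ _); rewrite -(card_imset H (addIr t)); apply: eq_card => x.
  apply/idP/imsetP => [xH|[y yH ->]].
    by exists (x + t) => //=; rewrite -addrA addxx addr0.
  by rewrite unfold_in /= -addrA addxx addr0.
have H0 : #|H|%:R != 0 :> R.
  by apply: contra_eq_neq pmu.2 => H0; rewrite sumH H0 mul0r eq_sym oner_neq0.
exists H, t; split.
- by rewrite inE addr0.
- by move=> x y xH yH; rewrite inE addrA shift //; move: xH; rewrite inE.
- move=> x; rewrite muE; case: ifP => // _.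
  by apply: (mulfI H0); rewrite divff // -sumH pmu.2.
Qed.

Lemma ent_unif_coset (H : {set G}) (t : G) (mu : G -> R) :
  pmf mu -> (forall x, mu x = if x + t \in H then #|H|%:R^-1 else 0) ->
  ent mu id = ln #|H|%:R.
Proof.
move=> pmu muE; rewrite /ent (eq_bigr (fun x => mu x * - ln #|H|%:R)).
  by rewrite -mulr_suml pmu.2 mul1r opprK.
move=> x _; rewrite law_id muE; case: ifP => xH; last by rewrite !mul0r.
by rewrite lnV // posrE ltr0n (cardD1 (x + t)) xH.
Qed.

(** Let X have law [p] and U law [mu]. As [psi] U is constant, submodularity for X and X + U given
    [psi] X yields [H(psi X) + ln |H| <= H(X + U)], while [H(X) <= H(psi X) + ln |H|] because fibres
    of [psi] are cosets of [H]. *)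
Lemma ent_mod_coset (G' : finZmodType) (psi : {additive G -> G'}) (H : {set G}) (t : G)
    (mu p : G -> R) :
  pmf mu -> pmf p -> (forall x, mu x = if x + t \in H then #|H|%:R^-1 else 0) ->
  (forall x, (x \in H) = (psi x == 0)) ->
  ent p psi <= 2 * rd p id mu id.
Proof.
move=> pmu pp muE psiH; have pw := pmf_prod pp pmu.
have psimu x : mu x != 0 -> psi x = - psi t.
  rewrite muE; case: ifP => [|_]; last by rewrite eqxx.
  by rewrite psiH raddfD addr_eq0 => /eqP.
have := ent_unif_coset pmu muE.
set l := ln _ => hl.
have := ent_submod pw (fun x => x.1) (fun x => x.1 + x.2) (fun x => psi x.1).
rewrite (@ent_eq _ _ _ pw _ _ _ (fun x => (x.1, x.2))); first last.
- by move=> i j _ _ [-> ->].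
- by move=> i j _ _ [->] /addrI ->.
rewrite (ent_prod id id pp pmu) (ent_fst p psi pmu).
rewrite (@ent_eq _ _ _ pw _ _ _ (fun x => x.1)); first last.
- by move=> i j _ _ ->.
- by move=> i j _ _ [].
rewrite (ent_fst p id pmu).
rewrite (@ent_eq _ _ _ pw _ _ _ (fun x => x.1 + x.2)); first last.
- move=> i j; rewrite /prodp !mulf_eq0 !negb_or => /andP[_ i2] /andP[_ j2] e.
  congr (_, _) => //; have := congr1 psi e.
  by rewrite !raddfD (psimu i.2) // (psimu j.2) // => /addIr.
- by move=> i j _ _ [].
have : ent p id <= ent p psi + l.
  rewrite (@ent_eq _ _ _ pp _ _ _ (fun x => (x, psi x))); first last.
  - by move=> i j _ _ [].
  - by move=> i j _ _ ->.
  rewrite (ent_chain _ psi pp) lerD2l -[l]mul1r -(pmf_law psi pp).2 mulr_suml.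
  apply: ler_sum => z _; have [->|z0] := eqVneq (law p psi z) 0.
    by rewrite !mul0r.
  apply: ler_wpM2l; first exact: law_ge0.
  have [x0 /eqP ex0] : exists x0, psi x0 == z.
    apply/existsP; apply: contraNT z0 => /existsPn nz.
    by rewrite /law big1 // => i /eqP e; have := nz i; rewrite e eqxx.
  have -> : l = ln #|[set x0 + h | h in H]|%:R by rewrite card_imset //; exact: addrI.
  apply: ent_le_ln_card; first exact: pmf_cond.
  move=> i; rewrite /cond; have [e _|_] := eqVneq (psi i) z; last by rewrite eqxx.
  by apply/imsetP; exists (i - x0); rewrite ?psiH ?raddfB ?e ?ex0 ?subrr // addrC subrK.
by rewrite /rd hl => *; lra.
Qed.

Lemma entropic_pfr (x0 y0 : G -> R) : pmf x0 -> pmf y0 ->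
  exists (H : {set G}) (t : G) (mu : G -> R),
  [/\ pmf mu, (0 \in H /\ {in H &, forall x y, x + y \in H}),
    (forall x, mu x = if x + t \in H then #|H|%:R^-1 else 0),
    rd x0 id mu id <= 102 * rd x0 id y0 id & rd y0 id mu id <= 102 * rd x0 id y0 id].
Proof.
move=> px py; pose eta : R := 1 / 100.
have eta0 : 0 <= eta by rewrite /eta; lra.
have [mu [nu [pmu pnu Fmin]]] := exists_rd_minimizer eta px py.
have k0 : rd mu id nu id = 0.
  apply: (local_min_rd0 addxx pmu pnu _ eta0); last by rewrite /eta.
  move=> p q pp pq; have le := Fmin p q pp pq.
  have := rd_triangle px pmu pp; have := rd_triangle py pnu pq.
  by move: le; rewrite /eta => *; lra.
(* The competitor is the swapped pair: both penalties are then [rd x0 id y0 id], whereas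
   [rd x0 id x0 id] need not vanish. The minimum is thus at most [1.02] times this distance;
   dividing by [eta] gives 102. *)
have := Fmin y0 x0 py px; rewrite k0 (rdC y0 id x0) => le.
have xm := rd_ge0 id id px pmu; have yn := rd_ge0 id id py pnu.
have mm0 : rd mu id mu id = 0.
  apply/eqP; rewrite eq_le rd_ge0 // andbT.
  by have := rd_triangle pmu pnu pmu; rewrite (rdC nu) k0 addr0.
have [H [t [H0 HD muE]]] := rd_self0_coset pmu mm0.
have ym := rd_triangle py pnu pmu; rewrite (rdC nu) k0 addr0 in ym.
exists H, t, mu; split => //; move: le; rewrite /eta => *; lra.
Qed.

End Char2.

(** * Projections over F_2 *)

Section F2.
Variable R : realType.

Lemma F2_cases (a : 'F_2) : a = 0 \/ a = 1.
Proof. by case: a => [[|[|//]]] i; [left|right]; apply: val_inj. Qed.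

Lemma addxx_F2 n (x : 'rV['F_2]_n) : x + x = 0.
Proof. by apply/rowP => i; rewrite !mxE; case: (F2_cases (x 0 i)) => ->; apply: val_inj. Qed.

(** Over F_2 the scalars are 0 and 1, so a set containing 0 and closed under addition is a subspace;
    [M] is a cokernel of the matrix listing its elements. *)
Lemma F2_subgroup_mx n (H : {set 'rV['F_2]_n}) :
  0 \in H -> {in H &, forall x y, x + y \in H} ->
  exists2 M : 'M['F_2]_n, (forall x, (x \in H) = (x *m M == 0)) &
    (2 ^ (n - \rank M) <= #|H|)%N.
Proof.
move=> H0 HD; pose A : 'M['F_2]_(#|H|, n) := \matrix_(i < #|H|) enum_val i.
have HA x : (x \in H) = (x <= A)%MS.
  apply/idP/idP => [xH|/submxP[D ->]].
    have -> : x = row (enum_rank_in xH x) A by rewrite rowK enum_rankK_in.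
    exact: row_sub.
  rewrite mulmx_sum_row; apply: (big_ind (fun y => y \in H)) => // i _.
  rewrite rowK; case: (F2_cases (D 0 i)) => ->; first by rewrite scale0r.
  by rewrite scale1r enum_valP.
exists (cokermx A) => [x|]; first by rewrite HA submxE.
rewrite mxrank_coker subKn ?rank_leq_col //.
have inj : injective (fun u : 'rV_(\rank A) => u *m row_base A).
  by move=> u v; apply: row_free_inj; exact: row_base_free.
have := card_imset predT inj; rewrite card_mx card_Fp // mul1n => <-.
apply/subset_leq_card/subsetP => _ /imsetP[u _ ->].
by rewrite HA (submx_trans (submxMl _ _)) // eq_row_base.
Qed.

(** [204 = 2 * 102] comes from [ent_mod_coset]. The corank of [M] is controlled by [ln |H|], which
    exceeds each of the two entropies by at most twice the distance to the coset. *)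
Lemma F2_pfr n (p q : 'rV['F_2]_n -> R) (k := rd p id q id) :
  pmf p -> pmf q -> exists M : 'M['F_2]_n,
  [/\ (n - \rank M)%:R * ln 2 <= (ent p id + ent q id) / 2 + 204 * k,
      ent p (mulmxr M) <= 204 * k & ent q (mulmxr M) <= 204 * k].
Proof.
move=> pp pq.
have [H [t [mu [pmu [H0 HD] muE dp dq]]]] := entropic_pfr (@addxx_F2 n) pp pq.
have [M HM cM] := F2_subgroup_mx H0 HD; exists M.
have hM x : (x \in H) = (mulmxr M x == 0) by rewrite HM.
have mp := ent_mod_coset pmu pp muE hM; have mq := ent_mod_coset pmu pq muE hM.
split; [|rewrite /k; lra|rewrite /k; lra].
have := rd_ge id id pmu pp; have := rd_ge id id pmu pq.
rewrite !(rdC mu) (ent_unif_coset pmu muE) => h1 h2.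
have : (n - \rank M)%:R * ln 2 <= ln #|H|%:R :> R.
  rewrite mulr_natl -lnXn // ler_ln ?posrE ?exprn_gt0 ?ltr0n //.
    by rewrite -natrX ler_nat.
  by apply: leq_trans cM; rewrite expn_gt0.
rewrite /k; lra.
Qed.

Lemma corank_mul (F : fieldType) n (M M' : 'M[F]_n) :
  (n - \rank (M *m M') <= (n - \rank M) + (n - \rank M'))%N.
Proof.
have := mxrank_mul_min M M'; have := rank_leq_row M; have := rank_leq_row M'.
by move: (\rank M) (\rank M') (\rank (M *m M')) => a b c *; lia.
Qed.

(** The invariant [P] says that the corank is paid for by twice the entropy lost. Iteration is
    replaced by a choice of [M] of minimal rank satisfying [P]: if the remaining entropy exceeded
    [1000 d], [F2_pfr] applied to the images would give an [M'] with [P (M *m M')] and remaining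
    entropy at most [408 d]. *)
Lemma F2_projection (I J : finType) n (p : I -> R) (f : I -> 'rV['F_2]_n)
    (q : J -> R) (g : J -> 'rV['F_2]_n) : pmf p -> pmf q ->
  exists M : 'M['F_2]_n, (n - \rank M)%:R * ln 2 <= 2 * (ent p f + ent q g) /\
    ent p (fun i => f i *m M) + ent q (fun j => g j *m M) <=
    1000 * rd p (fun i => f i *m M) q (fun j => g j *m M).
Proof.
move=> pp pq.
pose E (M : 'M['F_2]_n) := ent p (fun i => f i *m M) + ent q (fun j => g j *m M).
pose P (M : 'M['F_2]_n) := (n - \rank M)%:R * ln 2 <= 2 * (ent p f + ent q g - E M).
have E0 M : 0 <= E M by rewrite addr_ge0 ?ent_ge0.
have P1 : P 1%:M.
  rewrite /P mxrank1 subnn mul0r /E.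
  rewrite (_ : ent p _ = ent p f); last by apply: eq_ent => // i; rewrite mulmx1.
  rewrite (_ : ent q _ = ent q g); last by apply: eq_ent => // i; rewrite mulmx1.
  by rewrite subrr mulr0.
pose M := [arg min_(M < 1%:M | P M) \rank M]%N.
have [PM Mmin] : P M /\ forall M', P M' -> (\rank M <= \rank M')%N.
  by rewrite /M; case: arg_minnP.
exists M; split; first by move: PM; have := E0 M; rewrite /P => *; lra.
rewrite leNgt; apply/negP => big.
set d := rd _ _ _ _ in big.
have [M' []] := F2_pfr (pmf_law (fun i => f i *m M) pp) (pmf_law (fun j => g j *m M) pq).
rewrite -rd_law_id -/d -!ent_comp => r1 e1 e2.
have EM' : E (M *m M') <= 408 * d.
  rewrite /E (eq_ent (frefl p) (_ : _ =1 mulmxr M' \o (fun i => f i *m M))); last first.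
    by move=> i /=; rewrite mulmxA.
  rewrite (eq_ent (frefl q) (_ : _ =1 mulmxr M' \o (fun i => g i *m M))); last first.
    by move=> i /=; rewrite mulmxA.
  lra.
have {}r1 : (n - \rank M')%:R * ln 2 <= E M / 2 + 204 * d by exact: r1.
have dE : 1000 * d < E M by exact: big.
have d0 : 0 <= d by apply: rd_ge0.
have rk := corank_mul M M'.
have PMM' : P (M *m M').
  rewrite /P; have l2 : 0 <= ln 2 :> R by apply: ln_ge0; rewrite ler1n.
  have : (n - \rank (M *m M'))%:R * ln 2 <= ((n - \rank M) + (n - \rank M'))%:R * ln 2 :> R.
    by rewrite ler_wpM2r // ler_nat.
  by rewrite natrD mulrDl; move: PM; rewrite /P => *; lra.
(* By minimality [M'] is injective on the image of [M], so it loses no entropy, contrary to the drop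
   from above [1000 d] to at most [408 d]. *)
have := Mmin _ PMM' => rkle.
have inj x y : x *m M *m M' = y *m M *m M' -> x *m M = y *m M.
  move=> e; apply/eqP; rewrite -subr_eq0 -mulmxBl -submx0.
  have : \rank (M *m M') = \rank M by apply/eqP; rewrite eqn_leq rkle mxrankM_maxl.
  move/mxrank_injP/eqP <-; rewrite sub_capmx submxMl; apply/sub_kermxP.
  by rewrite !mulmxBl e subrr.
have : E M <= E (M *m M').
  apply: lerD; apply: ent_le => // i j _ _; rewrite !mulmxA; exact: inj.
by move=> *; lra.
Qed.

End F2.

(** * Reduction modulo 2 *)

Section Fibring.
Variable R : realType.

(** Submodularity for X + Y and the pair of projections, given the sum of the projections, which is
    itself a function of X + Y. *)
Lemma avg_rd_fibre (G : zmodType) (G' : finZmodType) (pi : {additive G -> G'})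
    (I J : finType) (p : I -> R) (f : I -> G) (q : J -> R) (g : J -> G)
    (Z := fun i => pi (f i)) (W := fun j => pi (g j)) :
  pmf p -> pmf q ->
  \sum_z \sum_w law p Z z * law q W w * rd (cond p Z z) f (cond q W w) g <=
  rd p f q g - rd p Z q W.
Proof.
move=> pp pq; have pw := pmf_prod pp pq; rewrite avg_rd //.
have := ent_submod pw (fun x => f x.1 + g x.2) (fun x => (Z x.1, W x.2))
  (fun x => Z x.1 + W x.2).
rewrite (@ent_eq _ _ _ pw _ _ _ (fun x => (f x.1 + g x.2, (Z x.1, W x.2)))); first last.
- by move=> i j _ _ [-> -> ->].
- by move=> i j _ _ [-> -> ->].
rewrite (@ent_eq _ _ _ pw _ _ (fun x => (f x.1 + g x.2, Z x.1 + W x.2))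
  (fun x => f x.1 + g x.2)); first last.
- by move=> i j _ _ e; rewrite /Z /W -!raddfD e.
- by move=> i j _ _ [].
rewrite (@ent_eq _ _ _ pw _ _ (fun x => (Z x.1, W x.2, Z x.1 + W x.2))
  (fun x => (Z x.1, W x.2))); first last.
- by move=> i j _ _ [-> ->].
- by move=> i j _ _ [-> ->].
rewrite (ent_prod Z W pp pq).
rewrite (@ent_eq _ _ _ pp _ _ (fun i => (f i, Z i)) f); first last.
- by move=> i j _ _; rewrite /Z => ->.
- by move=> i j _ _ [].
rewrite (@ent_eq _ _ _ pq _ _ (fun i => (g i, W i)) g); first last.
- by move=> i j _ _; rewrite /W => ->.
- by move=> i j _ _ [].
by rewrite /rd => *; lra.
Qed.

(* Torsion-freeness enters only through the injectivity of [y |-> y + y]. *)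
Lemma ent_mod2_le (I J : finType) n (p : I -> R) (f : I -> 'rV[int]_n)
    (q : J -> R) (g : J -> 'rV[int]_n) : pmf p -> pmf q ->
  ent p (fun i => map_mx intr (f i) : 'rV['F_2]_n) <= 4 * rd p f q g.
Proof.
move=> pp pq; pose phi (u : 'rV[int]_n) : 'rV['F_2]_n := map_mx intr u.
have phi2 (u v : 'rV[int]_n) : phi (u + (v + v)) = phi u.
  by rewrite /phi !raddfD /= addxx_F2 addr0.
have dbl (u v : 'rV[int]_n) : u + u = v + v -> u = v.
  move/rowP=> e; apply/rowP => i; have {e} := e i; rewrite !mxE.
  by move: (u _ i) (v _ i) => a b; lia.
have pqp := pmf_prod pq pp; have pw := pmf_prod pqp pq.
pose Z (x : J * I) := f x.2 + (g x.1 + g x.1).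
(* X and X + 2Y determine Y because doubling is injective, and X + 2Y agrees with X modulo 2;
   submodularity is applied given X mod 2. *)
have low : ent q g + ent p (phi \o f) <= ent (q \ox p) Z.
  have := ent_submod pqp (fun x => f x.2) Z (fun x => phi (f x.2)).
  rewrite (@ent_eq _ _ _ pqp _ _ _ (fun x => (g x.1, f x.2))); first last.
  - by move=> i j _ _; rewrite /Z => -[-> ->].
  - by move=> i j _ _; rewrite /Z => -[-> /addrI/dbl->].
  rewrite (@ent_eq _ _ _ pqp _ _ (fun x => (f x.2, phi (f x.2))) (fun x => f x.2)); first last.
  - by move=> i j _ _ ->.
  - by move=> i j _ _ [].
  rewrite (@ent_eq _ _ _ pqp _ _ (fun x => (Z x, phi (f x.2))) Z); first last.
  - by move=> i j _ _ e; have := congr1 phi e; rewrite [in X in X -> _]/Z !phi2 => e2; rewrite e e2.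
  - by move=> i j _ _ [].
  rewrite (ent_prod g f pq pp) (ent_snd p f pq) (ent_snd p (phi \o f) pq).
  by move=> *; lra.
(* For the upper bound X + 2Y is split as (Y + X + Y') + (Y - Y') with a second copy Y'. Both
   summands have small entropy, whence [H(X + 2Y) <= 4 H(X + Y) - 2 H(X) - H(Y)]. *)
pose P (x : J * I * J) := g x.1.1 + f x.1.2 + g x.2.
pose Q (x : J * I * J) := g x.1.1 - g x.2.
have PQ x : P x + Q x = Z x.1 by rewrite /P /Q /Z; apply/rowP => i; rewrite !mxE; ring.
have := ent_submod pw (fun x => (P x, Q x)) (fun x => (g x.1.1, f x.1.2)) (fun x => Z x.1).
rewrite (@ent_eq _ _ _ pw _ _ _ (fun x => ((g x.1.1, f x.1.2), g x.2))); first last.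
- by move=> i j _ _; rewrite /P /Q /Z => -[-> -> ->].
- by move=> i j _ _; rewrite /P => -[e1 _ e2 e3 _]; move: e1; rewrite e2 e3 => /addrI ->.
rewrite (@ent_eq _ _ _ pw _ _ (fun x => (P x, Q x, Z x.1)) (fun x => (P x, Q x))); first last.
- by move=> i j _ _ [e1 e2]; rewrite -!PQ e1 e2.
- by move=> i j _ _ [-> ->].
rewrite (@ent_eq _ _ _ pw _ _ (fun x => (g x.1.1, f x.1.2, Z x.1))
  (fun x => (g x.1.1, f x.1.2))); first last.
- by move=> i j _ _; rewrite /Z => -[-> ->].
- by move=> i j _ _ [-> ->].
rewrite (@ent_prod _ _ _ _ _ (q \ox p) q (fun x => (g x.1, f x.2)) g) //.
rewrite (@ent_fst _ _ _ _ (q \ox p) q Z) //.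
rewrite (@ent_fst _ _ _ _ (q \ox p) q (fun x => (g x.1, f x.2))) //.
rewrite (ent_prod g f pq pp).
have := ent_pair_le pw P Q; have := kaimanovich_vershik g f g pq pp pq.
have := ent_sub_triangle g f g pq pp pq; rewrite -/P.
rewrite -(ent_triple13 q q pp (fun x => g x.1 - g x.2)) -/Q.
rewrite -(ent_addC p f q g) /rd.
have -> : ent p (fun i => map_mx intr (f i) : 'rV['F_2]_n) = ent p (phi \o f) by [].
by move: low => *; lra.
Qed.

End Fibring.

(** * Lattice coordinates *)

(* The rows of C are the coordinates of the rows of M in a basis (the rows of B)
   of the lattice they generate: by [L *m C = 1%:M] they generate all of Z^r. *)
Lemma int_row_lattice_basis m n (M : 'M[int]_(m, n)) :
  exists r (C : 'M[int]_(m, r)) (B : 'M[int]_(r, n)) (L : 'M[int]_(r, m)),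
  [/\ M = C *m B, L *m C = 1%:M & injective (fun u : 'rV[int]_r => u *m B)].
Proof.
have [P uP [Q uQ [d _ defM]]] := int_Smith_normal_form M.
set D := \matrix_(i, j) _ in defM.
pose K := [set k : 'I_m | (d`_k != 0) && (k < n)%N].
pose e (j : 'I_#|K|) : 'I_m := enum_val j.
have DK k l : k \notin K -> D k l = 0.
  rewrite inE negb_and negbK mxE -leqNgt => /orP[/eqP->|le]; first by rewrite mul0rn.
  by case: eqP => // kl; have := ltn_ord l; rewrite -kl ltnNge le.
(* The diagonal factors go into [B], so that [C] consists of columns of the unimodular [P], and rows
   of the inverse of [P] serve as [L]. *)
exists #|K|, (colsub e P), (rowsub e (D *m Q)), (rowsub e (invmx P)); split.
- rewrite defM -mulmxA; apply/matrixP => i l; rewrite mxE [RHS]mxE.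
  transitivity (\sum_(k in K) P i k * (D *m Q) k l).
    rewrite (bigID (mem K)) /= [X in _ + X]big1 ?addr0 // => k kK.
    by rewrite [_ k l]mxE big1 ?mulr0 // => l' _; rewrite DK ?mul0r.
  rewrite (big_enum_val (fun k => P i k * (D *m Q) k l)).
  by apply: eq_bigr => j _; rewrite [colsub _ _ _ _]mxE [rowsub _ _ _ _]mxE.
- apply/matrixP => i j; rewrite mxE.
  transitivity ((invmx P *m P) (e i) (e j)).
    by rewrite mxE; apply: eq_bigr => k _; rewrite !mxE.
  by rewrite mulVmx // !mxE (inj_eq enum_val_inj).
move=> u v /eqP; rewrite -subr_eq0 -mulmxBl => /eqP w0.
apply/eqP; rewrite -subr_eq0; apply/eqP; move: (u - v) w0 => w w0.
have {}w0 : w *m rowsub e D = 0.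
  rewrite -[LHS](mulmxK uQ) -(mulmxA w).
  by rewrite (_ : rowsub e D *m Q = rowsub e (D *m Q)) ?w0 ?mul0mx // mul_rowsub_mx.
apply/rowP => j; have := enum_valP j; rewrite inE => /andP[dj jn].
have /rowP/(_ (Ordinal jn)) := w0; rewrite mxE (bigD1 j) //= big1 => [|j' j'j].
  by rewrite !mxE eqxx addr0 => /eqP; rewrite mulf_eq0 (negPf dj) orbF => /eqP.
by rewrite !mxE /= (inj_eq val_inj) (inj_eq enum_val_inj) (negPf j'j) mulr0.
Qed.

(** Each set is translated by its own base point, but one lattice serves both, since one map has to
    act on both. Base points get coordinates 0. The coordinates generate Z^r and hence also F_2^r,
    so a matrix constant on both sets kills generators and is 0. *)
Lemma common_coordinates (I : finType) D (g : I -> 'rV[int]_D) (S T : {set I}) s0 t0 :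
  s0 \in S -> t0 \in T ->
  exists r (B : 'M[int]_(r, D)) (c c' : I -> 'rV[int]_r),
  [/\ {in S, forall i, g i = g s0 + c i *m B},
      {in T, forall i, g i = g t0 + c' i *m B},
      injective (fun u : 'rV[int]_r => u *m B) &
      forall M : 'M['F_2]_r,
        {in S, forall i, map_mx intr (c i) *m M = map_mx intr (c s0) *m M} ->
        {in T, forall i, map_mx intr (c' i) *m M = map_mx intr (c' t0) *m M} -> M = 0].
Proof.
move=> s0S t0T.
(* Indices outside the set get zero rows, so both blocks are indexed by all of [I]. *)
pose X (S : {set I}) s0 := \matrix_(k < #|I|)
  (if enum_val k \in S then g (enum_val k) - g s0 else 0).
have [r [C [B [L [eX LC injB]]]]] := int_row_lattice_basis (col_mx (X S s0) (X T t0)).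
pose c i := row (lshift #|I| (enum_rank i)) C; pose c' i := row (rshift #|I| (enum_rank i)) C.
have cB i : c i *m B = if i \in S then g i - g s0 else 0.
  by rewrite -row_mul -eX rowKu rowK enum_rankK.
have c'B i : c' i *m B = if i \in T then g i - g t0 else 0.
  by rewrite -row_mul -eX rowKd rowK enum_rankK.
have z (u : 'rV[int]_r) : u *m B = 0 -> u = 0 by move=> u0; apply: (injB u 0); rewrite /= u0 mul0mx.
exists r, B, c, c'; split=> //.
- by move=> i iS; rewrite cB iS addrC subrK.
- by move=> i iT; rewrite c'B iT addrC subrK.
move=> M hS hT.
have c0 i : map_mx intr (c i) *m M = 0.
  have [iS|iS] := boolP (i \in S).
    by rewrite hS // (z (c s0)) ?cB ?s0S ?subrr // map_mx0 mul0mx.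
  by rewrite (z (c i)) ?cB ?(negPf iS) // map_mx0 mul0mx.
have c'0 i : map_mx intr (c' i) *m M = 0.
  have [iT|iT] := boolP (i \in T).
    by rewrite hT // (z (c' t0)) ?c'B ?t0T ?subrr // map_mx0 mul0mx.
  by rewrite (z (c' i)) ?c'B ?(negPf iT) // map_mx0 mul0mx.
have CM : map_mx intr C *m M = 0.
  apply/row_matrixP => k; rewrite row0 row_mul -map_row.
  by case: (splitP k) => j kj; [rewrite -(c0 (enum_val j)) | rewrite -(c'0 (enum_val j))];
    congr (map_mx _ (row _ _) *m _); apply: val_inj; rewrite /= enum_valK.
by rewrite -[M]mul1mx -(map_mx1 intr) -LC map_mxM -mulmxA CM mulmx0.
Qed.

(** * Uniform laws on subsets and selection by averaging *)

Section Uniform.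
Variables (R : realType) (I : finType).

Definition unif (S : {set I}) (i : I) : R := if i \in S then #|S|%:R^-1 else 0.

Lemma card_gt0R (S : {set I}) i : i \in S -> 0 < #|S|%:R :> R.
Proof. by move=> iS; rewrite ltr0n (cardD1 i) iS. Qed.

Lemma unif_neq0 (S : {set I}) i : unif S i != 0 -> i \in S.
Proof. by rewrite /unif; case: ifP => //; rewrite eqxx. Qed.

Lemma pmf_unif (S : {set I}) i : i \in S -> pmf (unif S).
Proof.
move=> iS; split=> [j|].
  by rewrite /unif; case: ifP => // _; rewrite invr_ge0 ler0n.
by rewrite /unif -big_mkcond /= sumr_const -[LHS]mulr_natl mulfV // lt0r_neq0 // (card_gt0R iS).
Qed.

Lemma law_unif (T : eqType) (S : {set I}) (Z : I -> T) z :
  law (unif S) Z z = #|[set i in S | Z i == z]|%:R / #|S|%:R.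
Proof.
rewrite /law /unif -big_mkcondr /=.
rewrite (eq_bigl (mem [set i in S | Z i == z])); last by move=> i; rewrite !inE andbC.
by rewrite sumr_const -[LHS]mulr_natl.
Qed.

Lemma cond_unif (T : eqType) (S : {set I}) (Z : I -> T) z :
  law (unif S) Z z != 0 -> cond (unif S) Z z =1 unif [set i in S | Z i == z].
Proof.
move=> z0 i; rewrite /cond /unif inE andbC; case: eqP => //= _.
case: ifP => [iS|_]; last by rewrite mul0r.
by rewrite law_unif invf_div mulrA mulVf ?mul1r // lt0r_neq0 // (card_gt0R iS).
Qed.

Lemma ent_unif (T : eqType) (S : {set I}) (f : I -> T) s0 :
  s0 \in S -> {in S &, injective f} -> ent (unif S) f = ln #|S|%:R.
Proof.
move=> sS fi; have pS := pmf_unif sS.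
rewrite (@ent_eq _ _ _ pS _ _ f id); first last.
- by move=> i j _ _ ->.
- by move=> i j /unif_neq0 iS /unif_neq0 jS /fi ->.
rewrite /ent (eq_bigr (fun x => unif S x * - ln #|S|%:R)).
  by rewrite -mulr_suml pS.2 mul1r opprK.
move=> x _; rewrite law_id /unif; case: ifP => xS; last by rewrite !mul0r.
by rewrite lnV // posrE (card_gt0R xS).
Qed.

End Uniform.

(** The nonzero weight of the index found guarantees that the fibres selected with it are
    nonempty. *)
Lemma exists_le_average (R : realType) (I : finType) (a F : I -> R) (B : R) :
  (forall i, 0 <= a i) -> \sum_i a i = 1 -> \sum_i a i * F i <= B ->
  exists2 i, a i != 0 & F i <= B.
Proof.
move=> a0 a1 le; have [/existsP[i /andP[ai Fi]]|/existsPn n] :=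
  boolP [exists i, (a i != 0) && (F i <= B)]; first by exists i.
have : 0 < \sum_i a i * (F i - B).
  have [i ai] : exists i, a i != 0.
    apply/existsP; apply: contra_eqT a1 => /existsPn n0; rewrite big1.
      by rewrite eq_sym oner_eq0.
    by move=> i _; apply/eqP; have := n0 i; rewrite negbK.
  have pos j : a j != 0 -> 0 < a j * (F j - B).
    move=> aj; have := n j; rewrite aj /= -ltNge => lt.
    by rewrite mulr_gt0 ?subr_gt0 // lt_neqAle eq_sym aj a0.
  rewrite (bigD1 i) //= ltr_pwDl ?pos // sumr_ge0 // => j _.
  by have [->|/pos/ltW//] := eqVneq (a j) 0; rewrite mul0r.
under eq_bigr do rewrite mulrBr.
by rewrite sumrB -mulr_suml a1 mul1r subr_gt0 ltNge le.
Qed.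

(** A bound on the dimension in integer terms, turned into one on [has_dim] only at the end. *)
Definition affine_rank_le (I : finType) D (g : I -> 'rV[int]_D) (S : {set I}) r : Prop :=
  exists (b : 'rV[int]_D) (B : 'M[int]_(r, D)),
    {in S, forall i, exists c, g i = b + c *m B}.

(** * Weak polynomial Freiman-Ruzsa over the integers *)

(** Separate translations of [S] and [T] merely translate the sum by [b + b'], and [B] acts
    injectively. *)
Lemma rd_unif_coordinates (R : realType) (I : finType) D r (g : I -> 'rV[int]_D)
    (S T : {set I}) s0 t0 b b' (B : 'M[int]_(r, D)) (c c' : I -> 'rV[int]_r) :
  s0 \in S -> t0 \in T ->
  {in S, forall i, g i = b + c i *m B} -> {in T, forall i, g i = b' + c' i *m B} ->
  injective (fun u : 'rV[int]_r => u *m B) ->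
  rd (unif R S) c (unif R T) c' = rd (unif R S) g (unif R T) g.
Proof.
move=> s0S t0T gS gT injB; have pS := pmf_unif R s0S; have pT := pmf_unif R t0T.
have cinj (u v : 'rV[int]_r) : u *m B = v *m B -> u = v by apply: injB.
have eS : ent (unif R S) c = ent (unif R S) g.
  apply: ent_eq => // i j /unif_neq0 iS /unif_neq0 jS.
    by rewrite (gS i) // (gS j) // => ->.
  by rewrite (gS i) // (gS j) // => /addrI/cinj.
have eT : ent (unif R T) c' = ent (unif R T) g.
  apply: ent_eq => // i j /unif_neq0 iT /unif_neq0 jT.
    by rewrite (gT i) // (gT j) // => ->.
  by rewrite (gT i) // (gT j) // => /addrI/cinj.
have gST (x : I * I) : (unif R S \ox unif R T) x != 0 ->
    g x.1 + g x.2 = (b + b') + (c x.1 + c' x.2) *m B.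
  rewrite mulf_eq0 negb_or => /andP[/unif_neq0 x1 /unif_neq0 x2].
  by rewrite (gS _ x1) (gT _ x2) addrACA mulmxDl.
rewrite /rd eS eT; congr (_ - _); apply: ent_eq; first exact: pmf_prod.
  by move=> x y /gST-> /gST-> ->.
by move=> x y /gST-> /gST-> /addrI/cinj.
Qed.

(** Only a subset of [S] is wanted, but two sets must be carried: even from equal sets, averaging
    may pair two different fibres. *)
Lemma weak_pfr_sets (R : realType) (I : finType) D (g : I -> 'rV[int]_D) (S T : {set I})
    s0 t0 (d := rd (unif R S) g (unif R T) g) :
  injective g -> s0 \in S -> t0 \in T ->
  exists S' : {set I}, [/\ S' \subset S, S' != set0,
    ln #|S|%:R - ln #|S'|%:R <= 1000 * d &
    exists r, affine_rank_le g S' r /\ r%:R * ln 2 <= 16 * d].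
Proof.
move=> injg; have [N] := ubnP (#|S| + #|T|)%N.
elim: N S T s0 t0 @d => // N IH S T s0 t0 d leN s0S t0T.
have pS := pmf_unif R s0S; have pT := pmf_unif R t0T.
have d0 : 0 <= d by apply: rd_ge0.
have [r [B [c [c' [gS gT injB full]]]]] := common_coordinates g s0S t0T.
have dE : d = rd (unif R S) c (unif R T) c' by rewrite (rd_unif_coordinates R s0S t0T gS gT).
have [M [rM EM]] := F2_projection (fun i => map_mx intr (c i))
  (fun i => map_mx intr (c' i)) pS pT.
have fS := ent_mod2_le c c' pS pT; have fT := ent_mod2_le c' c pT pS.
rewrite (rdC (unif R T)) -dE in fT; rewrite -dE in fS.
have [M0|M0] := eqVneq M 0.
  exists S; split => //; first by apply/set0Pn; exists s0.
    by rewrite subrr mulr_ge0.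
  exists r; split; first by exists (g s0), B => i iS; exists (c i); exact: gS.
  (* [16 = 2 * (4 + 4)]: both reductions modulo 2 have entropy at most [4 d]. *)
  by move: rM fS fT; rewrite M0 mxrank0 subn0; clear; move=> *; lra.
pose pi : {additive 'rV[int]_r -> 'rV['F_2]_r} := (mulmxr M \o map_mx intr).
pose Z i := pi (c i); pose W i := pi (c' i).
pose a (zw : 'rV['F_2]_r * 'rV['F_2]_r) := law (unif R S) Z zw.1 * law (unif R T) W zw.2.
have [lZ0 lZ1] := pmf_law Z pS; have [lW0 lW1] := pmf_law W pT.
(* Distance between the fibres, at the rate 1000, plus both logarithmic losses of cardinality. By
   the fibre inequality and [F2_projection] the average is at most [1000 (d - d') + 1000 d'], where
   [d'] is the distance of the projections. *)
pose F (zw : 'rV['F_2]_r * 'rV['F_2]_r) :=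
  1000 * rd (cond (unif R S) Z zw.1) c (cond (unif R T) W zw.2) c'
  - ln (law (unif R S) Z zw.1) - ln (law (unif R T) W zw.2).
have [[z w] /=] : exists2 zw, a zw != 0 & F zw <= 1000 * d.
  apply: exists_le_average.
  - by move=> zw; rewrite mulr_ge0.
  - rewrite /a -(pair_bigA _ (fun z w => law (unif R S) Z z * law (unif R T) W w)) /=.
    by under eq_bigr do rewrite -mulr_sumr lW1 mulr1.
  have := avg_rd_fibre pi c c' pS pT; rewrite -/Z -/W -dE => fib.
  have {}EM : ent (unif R S) Z + ent (unif R T) W <= 1000 * rd (unif R S) Z (unif R T) W.
    exact: EM.
  rewrite -(pair_bigA _ (fun z w => a (z, w) * F (z, w))) /=.
  have -> : \sum_z \sum_w a (z, w) * F (z, w) =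
     1000 * (\sum_z \sum_w law (unif R S) Z z * law (unif R T) W w *
       rd (cond (unif R S) Z z) c (cond (unif R T) W w) c')
     + ent (unif R S) Z + ent (unif R T) W.
    pose lnZ z := law (unif R S) Z z * ln (law (unif R S) Z z).
    pose lnW w := law (unif R T) W w * ln (law (unif R T) W w).
    rewrite [ent _ Z]entE [ent _ W]entE -/(lnZ _) -/(lnW _).
    have -> : \sum_z lnZ z = \sum_z \sum_w law (unif R T) W w * lnZ z.
      by apply: eq_bigr => z _; rewrite -mulr_suml lW1 mul1r.
    have -> : \sum_w lnW w = \sum_z \sum_w law (unif R S) Z z * lnW w.
      rewrite exchange_big /=.
      by apply: eq_bigr => w _; rewrite -mulr_suml lZ1 mul1r.
    rewrite mulr_sumr -!sumrB; apply: eq_bigr => z _.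
    rewrite mulr_sumr -!sumrB; apply: eq_bigr => w _.
    by rewrite /a /F /lnZ /lnW /=; ring.
  by move: fib EM; clear; move=> *; lra.
rewrite mulf_eq0 negb_or => /andP[z0 w0].
rewrite /F /=.
rewrite (eq_rd (cond_unif z0) (frefl c) (cond_unif w0) (frefl c')).
set Sz := [set i in S | _]; set Tw := [set i in T | _].
have [s1 s1z] : exists s1, s1 \in Sz.
  apply/set0Pn; move: z0; rewrite law_unif -/Sz; apply: contraNneq => ->.
  by rewrite cards0 mul0r.
have [t1 t1w] : exists t1, t1 \in Tw.
  apply/set0Pn; move: w0; rewrite law_unif -/Tw; apply: contraNneq => ->.
  by rewrite cards0 mul0r.
have SzS : Sz \subset S by apply/subsetP => i; rewrite inE => /andP[].
have TwT : Tw \subset T by apply/subsetP => i; rewrite inE => /andP[].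
have gSz : {in Sz, forall i, g i = g s0 + c i *m B}.
  by move=> i /(subsetP SzS)/gS.
have gTw : {in Tw, forall i, g i = g t0 + c' i *m B}.
  by move=> i /(subsetP TwT)/gT.
rewrite (rd_unif_coordinates R s1z t1w gSz gTw injB) !law_unif -/Sz -/Tw.
rewrite !ln_div ?posrE ?(card_gt0R R s0S) ?(card_gt0R R t0T) ?(card_gt0R R s1z)
  ?(card_gt0R R t1w) //.
(* If neither set shrank, the projections would be constant on both sets, and fullness of the
   coordinates would give [M = 0]. *)
have lt : (#|Sz| + #|Tw| < #|S| + #|T|)%N.
  rewrite ltnNge; apply: contra M0 => ge.
  have le1 := subset_leq_card SzS; have le2 := subset_leq_card TwT.
  have /eqP eS : Sz == S by rewrite eqEcard SzS /=; move: ge le1 le2; clear; lia.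
  have /eqP eT : Tw == T by rewrite eqEcard TwT /=; move: ge le1 le2; clear; lia.
  have ZS i : i \in S -> Z i = z by rewrite -eS inE => /andP[_ /eqP].
  have WT i : i \in T -> W i = w by rewrite -eT inE => /andP[_ /eqP].
  apply/eqP/full => i iS; first by have := ZS i iS; rewrite -(ZS s0 s0S).
  by have := WT i iS; rewrite -(WT t0 t0T).
have [S' [S'Sz S'0 cS' [r' [aff dim]]]] := IH Sz Tw s1 t1 (leq_trans lt leN) s1z t1w.
have lnT : ln #|Tw|%:R <= ln #|T|%:R :> R.
  by rewrite ler_ln ?posrE ?(card_gt0R R t1w) ?(card_gt0R R t0T) // ler_nat subset_leq_card.
have lnS : ln #|Sz|%:R <= ln #|S|%:R :> R.
  by rewrite ler_ln ?posrE ?(card_gt0R R s1z) ?(card_gt0R R s0S) // ler_nat subset_leq_card.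
(* Both losses are nonnegative: hence the distance does not grow, and the loss in [S] telescopes
   with that of the recursive call, the loss in [T] being discarded. *)
have arith (lS lSz lT lTw l' e d' : R) :
    1000 * e - (lSz - lS) - (lTw - lT) <= 1000 * d' -> lTw <= lT -> lSz <= lS ->
    lSz - l' <= 1000 * e -> lS - l' <= 1000 * d' /\ e <= d'.
  by clear; move=> *; split; lra.
move=> /arith/(_ lnT lnS cS')[cS'' ed]; exists S'; split => //.
  exact: subset_trans SzS.
exists r'; split => //; apply: (le_trans dim).
by rewrite ler_pM2l.
Qed.

(** * From integer rank to real dimension, and the passage from sets to entropies *)

Lemma has_dim_le (R : realType) D (B : {fset 'rV[int]_D}) d w (W : {vspace 'rV[R]_D}) :
  has_dim R B d -> coset_contains w W B -> (d <= \dim W)%N.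
Proof.
move=> [v [V [[_ minV] <-]]] cW; apply/dimvS/subvP => u uV.
have v0 : in_coset w W v by apply: minV cW _ _; rewrite /in_coset subrr mem0v.
have vu : in_coset w W (v + u).
  by apply: minV cW _ _; rewrite /in_coset addrC addKr.
have -> : u = (v + u - w) - (v - w) by rewrite opprB subrKA addrC addKr.
exact: rpredB.
Qed.

Lemma has_dim_affine (R : realType) D (B : {fset 'rV[int]_D}) d r (b : 'rV[int]_D)
    (M : 'M[int]_(r, D)) :
  has_dim R B d -> (forall x, x \in B -> exists c, x = b + c *m M) -> (d <= r)%N.
Proof.
move=> dB BM; pose rows := [tuple row i (map_mx intr M) : 'rV[R]_D | i < r].
apply: leq_trans (has_dim_le (w := to_real R b) (W := <<rows>>%VS) dB _) _; last first.
  by apply: leq_trans (dim_span _) _; rewrite size_tuple.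
move=> x /BM[c ->]; rewrite /in_coset /to_real raddfD /= addrC addKr map_mxM mulmx_sum_row.
apply: rpred_sum => i _; apply: rpredZ; apply: memv_span.
by apply/mapP; exists i; rewrite ?mem_enum.
Qed.

Lemma rd_unif_sumset (R : realType) D (A : {fset 'rV[int]_D}) (a0 : A) :
  rd (unif R [set: A]) val (unif R [set: A]) val <=
  ln (#|` sumset A A|)%:R - ln (#|` A|)%:R.
Proof.
have pA : pmf (unif R [set: A]) by apply: (@pmf_unif _ _ _ a0); rewrite inE.
have cA : #|` A| = #|[set: A]| by rewrite cardsT cardfE.
rewrite /rd (ent_unif R (in_setT a0)); last by move=> x y _ _; apply: val_inj.
rewrite -cA.
have sumP (x : A * A) : val x.1 + val x.2 \in sumset A A.
  by apply/imfset2P; exists (val x.1); [exact: valP | exists (val x.2) => //; exact: valP].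
have pw := pmf_prod pA pA.
have := @ent_le_ln_card R _ _ _ (fun x => [` sumP x]%fset) [set: sumset A A] pw.
rewrite (@ent_eq _ _ _ pw _ _ (fun x => [` sumP x]%fset)
  (fun x => val x.1 + val x.2)); first last.
- by move=> x y _ _ e; apply: val_inj; exact: e.
- by move=> x y _ _ /(congr1 val).
rewrite cardsT -cardfE => /(_ (fun _ _ => in_setT _)) le.
by rewrite mulrDl -splitr lerD2r.
Qed.

Theorem theorem1p3 (R : realType) :
  exists C1 C2 : R, 0 < C1 /\ 0 < C2 /\
    forall (D : nat) (K : R) (A : {fset 'rV[int]_D}),
      (0 < D)%N ->
      A != fset0 ->
      (#|` sumset A A|)%:R <= K * (#|` A|)%:R ->
      exists A' : {fset 'rV[int]_D},
        (A' `<=` A)%fset /\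
        K `^ (- (C1 / 2)) * (#|` A|)%:R <= (#|` A'|)%:R /\
        exists d : nat, has_dim R A' d /\ d%:R <= C2 * ln K.
Proof.
have l2 : 0 < ln 2 :> R by rewrite ln_gt0 // ltr1n.
(* [C1 / 2 = 1000] and [16 / ln 2] are the constants of [weak_pfr_sets], where the distance is at
   most [ln K]. *)
exists 2000, (16 / ln 2); split; first by rewrite ltr0n.
split; first by rewrite divr_gt0.
move=> D K A _ /fset0Pn[a aA] AK; pose a0 : A := [` aA]%fset.
have A0 : 0 < (#|` A|)%:R :> R by rewrite ltr0n cardfs_gt0; apply/fset0Pn; exists a.
have AA0 : 0 < (#|` sumset A A|)%:R :> R.
  by rewrite ltr0n cardfs_gt0; apply/fset0Pn; exists (a + a); apply/imfset2P; exists a => //; exists a.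
have K0 : 0 < K by rewrite -(pmulr_lgt0 _ A0); apply: lt_le_trans AK.
have rdK : rd (unif R [set: A]) val (unif R [set: A]) val <= ln K.
  apply: le_trans (rd_unif_sumset R a0) _.
  by rewrite lerBlDr -lnM ?posrE // ler_ln ?posrE // mulr_gt0.
have [S [_ S0 cS [r [[b [B SB]] rS]]]] :=
  weak_pfr_sets R val_inj (in_setT a0) (in_setT a0).
exists [fsetval x in S]%fset.
have A'0 : [fsetval x in S]%fset != fset0.
  by have /set0Pn[x xS] := S0; apply/fset0Pn; exists (val x); apply: in_imfset.
have cA' : #|` [fsetval x in S]%fset| = #|S|.
  rewrite card_imfset /=; last exact: val_inj.
  by rewrite cardE.
split; first by apply/fsubsetP => _ /imfsetP[x _ ->]; apply: valP.
split.
  rewrite cA' -ler_ln ?posrE ?mulr_gt0 ?powR_gt0 //; last first.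
    by rewrite ltr0n lt0n cards_eq0.
  rewrite lnM ?posrE ?powR_gt0 // ln_powR.
  move: cS rdK; rewrite cardsT -cardfE; clear; move=> *; lra.
have [d dA'] := has_dim_exists R A'0; exists d; split=> //.
have dr : (d <= r)%N.
  by apply: has_dim_affine dA' _ => _ /imfsetP[x xS ->]; apply: SB.
rewrite mulrAC ler_pdivlMr //; apply: (@le_trans _ _ (r%:R * ln 2)).
  by rewrite ler_pM2r // ler_nat.
by apply: (le_trans rS); rewrite ler_pM2l // ltr0n.
Qed.
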